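(* Let $d\geq 2$ be a fixed integer, let $c_0\geq 1$ be a constant, and let $C_1=2^{10d}c_0$ and $C_2=2^{10d}c_0/\epsilon$, where $\epsilon$ is as below. Let $m=m(n)$, $p_1=(\log (mn))^{1/d}/(m^{(d-1)/(2d)}n^{(d-1)/(2d)})$ and $p_2=(\log n)^{1/d}/(m^{1/2}n^{(d-2)/(2d)})$. If $d$ is odd and $p_1 n\geq p_1 m\geq (\log n)^4$, then with probability at least $1-n^{-\Omega(1)}$ the random bipartite graph $G(m,n,C_1p_1)$ satisfies: every two distinct vertices in the same part are connected by at least $2^{10d}c_0\log n$ internally vertex-disjoint paths of length exactly $d+1$, and every two vertices in different parts are connected by at least $2^{10d}c_0\log n$ internally vertex-disjoint paths of length exactly $d$. If $d$ is even and $\epsilon$ is a fixed constant with $0<\epsilon<1$ such that $p_2 n^{1-\epsilon}\geq p_2 m^{1-\epsilon}\geq (\log n)^4$, then with probability at least $1-n^{-\Omega(1)}$ the random bipartite graph $G(m,n,C_2p_2)$ satisfies: every two distinct vertices in the same part are connected by at least $2^{10d}c_0\log n$ internally vertex-disjoint paths of length exactly $d$, and every two vertices in different parts are connected by at least $2^{10d}c_0\log n$ internally vertex-disjoint paths of length exactly $d+1$.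
   Context: $G(m,n,p)$ denotes the random bipartite graph with bipartition $(U,V)$, $|U|=m$, $|V|=n$, in which each edge $uv$ with $u\in U$, $v\in V$ is present independently with probability $p$. $\log$ denotes the logarithm to base $2$; asymptotic notation is as $n\to\infty$. *)

(* Defs.v *)
From HB Require Import structures.
From mathcomp Require Import all_boot all_order all_algebra.
From mathcomp Require Import boolp reals exp.
Set Implicit Arguments. Unset Strict Implicit. Unset Printing Implicit Defensive.
Import Order.TTheory GRing.Theory Num.Theory.
Local Open Scope ring_scope.

Section RandomBipartite.
Variable R : realType.

Definition log2 (x : R) : R := ln x / ln 2.

Definition vtx (m n : nat) := ('I_m + 'I_n)%type.

Definition adj m n (E : {set 'I_m * 'I_n}) (a b : vtx m n) : bool :=
  match a, b with
  | inl u, inr v => (u, v) \in E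
  | inr v, inl u => (u, v) \in E
  | _, _ => false
  end.

Definition is_path_len m n (E : {set 'I_m * 'I_n}) (L : nat) (x y : vtx m n)
    (s : seq (vtx m n)) : bool :=
  [&& size s == L, path (adj E) x s, last x s == y & uniq (x :: s)].

Definition interior m n (y : vtx m n) (s : seq (vtx m n)) : seq (vtx m n) :=
  [seq v <- s | v != y].

Definition many_disjoint_paths m n (E : {set 'I_m * 'I_n}) (L : nat)
    (x y : vtx m n) (k : R) : Prop :=
  exists ps : seq (seq (vtx m n)),
    [/\ k <= (size ps)%:R,
        all (is_path_len E L x y) ps &
        pairwise (fun s t => ~~ has (fun v => v \in interior y t) (interior y s)) ps].

Definition connectivity_prop m n (Lsame Ldiff : nat) (k : R)
    (E : {set 'I_m * 'I_n}) : Prop :=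
  (forall u u' : 'I_m, u != u' -> many_disjoint_paths E Lsame (inl u) (inl u') k) /\
  (forall v v' : 'I_n, v != v' -> many_disjoint_paths E Lsame (inr v) (inr v') k) /\
  (forall (u : 'I_m) (v : 'I_n), many_disjoint_paths E Ldiff (inl u) (inr v) k).

(** Probability that G(m,n,p) has property P.  Each of the m*n possible edges is
    present independently with probability p; (p is clamped to [0,1], which is
    irrelevant in the regime of the theorem where p -> 0). *)
Definition clamp01 (p : R) : R := Num.max 0 (Num.min p 1).

Definition Gmnp_prob (m n : nat) (p : R) (P : {set 'I_m * 'I_n} -> Prop) : R :=
  let q := clamp01 p in
  \sum_(E : {set 'I_m * 'I_n} | `[< P E >]) q ^+ #|E| * (1 - q) ^+ (m * n - #|E|).

Definition p1 (d m n : nat) : R :=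
  (log2 (m * n)%:R) `^ (d%:R)^-1 /
    ((m%:R) `^ ((d%:R - 1) / (2 * d%:R)) * (n%:R) `^ ((d%:R - 1) / (2 * d%:R))).

Definition p2 (d m n : nat) : R :=
  (log2 n%:R) `^ (d%:R)^-1 /
    ((m%:R) `^ (2^-1) * (n%:R) `^ ((d%:R - 2) / (2 * d%:R))).

End RandomBipartite.
Arguments Gmnp_prob {R} m n p P.

(* Main.v *)
(** Fix two vertices x and y. The remaining vertices are split into
    classes modulo M, one for each level of two breadth-first trees grown from x
    and y. The first neighbourhood of x is cut into K groups of equal size, K
    being a large multiple of log n. At each further level a fresh vertex joins
    the group i when it is adjacent to group i and to no other group; since the
    tips have total size o(1/p), the number of such vertices dominates a binomial
    variable of mean of order p N |group i|, so all groups grow at the expected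
    rate with very high probability. Finally the edges between the tips of the
    two trees are exposed: if no k <= K/2 groups of x can be matched with k groups
    of y, then at least half of the groups on either side span no edge with each
    other. As the expected number of paths is C^d log n and C is large, this beats
    the 4^K choices of groups, and a matching of the groups yields disjoint paths.
    For d = 2, the number of common neighbours of two vertices of the same part
    is binomial. A union bound over the pairs x, y concludes. *)

Require Import Defs.
From HB Require Import structures.
From mathcomp Require Import all_boot all_order all_algebra.
From mathcomp Require Import ring lra zify.
From mathcomp Require Import boolp reals sequences exp.
Set Implicit Arguments.
Unset Strict Implicit.
Import Order.TTheory GRing.Theory Num.Theory.
Local Open Scope ring_scope.

(** * Random subsets of a finite set *)

Lemma exp2_le_expR (R : realType) t : (2 : R) ^+ t <= expR t%:R.
Proof.
rewrite -[X in expR X]mulr1 expRM_natl lerXn2r ?nnegrE ?expR_ge0 ?ler0n //.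
by have := expR_ge1Dx (1 : R); lra.
Qed.

Lemma bernoulli (R : realType) (x : R) k : -1 <= x -> 1 + k%:R * x <= (1 + x) ^+ k.
Proof.
move=> x1; elim: k => [|k IH]; first by rewrite mul0r addr0.
rewrite exprS -natr1; have := ler0n R k; have := sqr_ge0 x; rewrite expr2 => x2 k0.
have : 0 <= (1 + x) * ((1 + x) ^+ k - (1 + k%:R * x)) by apply: mulr_ge0; lra.
have : 0 <= k%:R * (x * x) by apply: mulr_ge0.
lra.
Qed.

(** Bernoulli bounds [(1 - x) ^+ k * (1 + z)] by [((1 - x) * (1 + x)) ^+ k <= 1], and
    [1 <= (1 + z) * (1 - z / 2)] for [z] in [0, 1]. *)
Lemma expr_1B_le_half (R : realType) (x : R) k : 0 <= x <= 1 -> k%:R * x <= 1 ->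
  (1 - x) ^+ k <= 1 - k%:R * x / 2.
Proof.
move=> /andP [x0 x1] kx1; set z := k%:R * x in kx1 *.
have z0 : 0 <= z by rewrite mulr_ge0.
have h : (1 - x) ^+ k * (1 + z) <= 1.
  apply: le_trans (_ : (1 - x) ^+ k * (1 + x) ^+ k <= _).
    by rewrite ler_wpM2l ?exprn_ge0 ?subr_ge0 // bernoulli; lra.
  by rewrite -exprMn exprn_ile1 //; nra.
rewrite -(@ler_pM2r _ (1 + z)); last lra.
apply: le_trans h _; have : 0 <= z * (1 - z) by apply: mulr_ge0; lra.
lra.
Qed.

Section RandomSubset.
Variables (R : realType) (I : finType) (q : R).
Hypothesis q01 : 0 <= q <= 1.
Implicit Types (E D F : {set I}) (P Q : pred {set I}) (f g : {set I} -> R).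

(** The product measure, with one factor per element so that sums over all sets factor by
    distributivity; [wtE] recovers the form used in [Gmnp_prob]. *)
Definition wt E : R := \prod_i (if i \in E then q else 1 - q).
Definition expct f : R := \sum_E wt E * f E.
Definition prob P : R := expct (fun E => (P E)%:R).

Let q_ge0 : 0 <= q. Proof. by case/andP: q01. Qed.
Let q_le1 : q <= 1. Proof. by case/andP: q01. Qed.

Lemma wt_ge0 E : 0 <= wt E.
Proof. by apply: prodr_ge0 => i _; case: ifP => _; rewrite ?subr_ge0. Qed.

Lemma wtE E : wt E = q ^+ #|E| * (1 - q) ^+ (#|I| - #|E|).
Proof.
rewrite /wt (bigID (mem E)) /=.
rewrite (eq_bigr (fun=> q)) => [|i ->//]; rewrite prodr_const; congr (_ * _).
rewrite (eq_bigr (fun=> 1 - q)) => [|i /negbTE ->//]; rewrite prodr_const.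
by congr (_ ^+ _); rewrite -(setCK E) -cardsCs setCK; apply: eq_card => i; rewrite !inE.
Qed.

Lemma wt_sum1 : \sum_E wt E = 1.
Proof.
rewrite /wt -(bigA_distr _ _ (fun=> q) (fun=> 1 - q)) big1 // => i _.
by rewrite /= addrC subrK.
Qed.

Lemma expct_cst c : expct (fun=> c) = c.
Proof. by rewrite /expct -mulr_suml wt_sum1 mul1r. Qed.

Lemma eq_expct f g : f =1 g -> expct f = expct g.
Proof. by move=> fg; apply: eq_bigr => E _; rewrite fg. Qed.

Lemma le_expct f g : (forall E, f E <= g E) -> expct f <= expct g.
Proof. by move=> fg; apply: ler_sum => E _; rewrite ler_wpM2l ?wt_ge0. Qed.

Lemma expctD f g : expct (fun E => f E + g E) = expct f + expct g.
Proof. by rewrite -big_split /=; apply: eq_bigr => E _; rewrite mulrDr. Qed.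

Lemma expctMl c f : expct (fun E => c * f E) = c * expct f.
Proof. by rewrite /expct mulr_sumr; apply: eq_bigr => E _; rewrite mulrCA. Qed.

Lemma expct_ge0 f : (forall E, 0 <= f E) -> 0 <= expct f.
Proof. by move=> f0; apply: sumr_ge0 => E _; rewrite mulr_ge0 ?wt_ge0. Qed.

Lemma le_prob P Q : (forall E, P E -> Q E) -> prob P <= prob Q.
Proof.
move=> PQ; apply: le_expct => E; rewrite ler_nat.
by case PE: (P E) => //; rewrite PQ.
Qed.

Lemma prob_le1 P : prob P <= 1.
Proof. by rewrite -[leRHS](expct_cst 1); apply: le_expct => E; case: (P E). Qed.

Lemma probU P Q : prob (fun E => P E || Q E) <= prob P + prob Q.
Proof.
rewrite -expctD; apply: le_expct => E.
by case: (P E); case: (Q E) => /=; lra.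
Qed.

Lemma prob_exists (J : finType) (A : pred J) (P : J -> pred {set I}) :
  prob (fun E => [exists (j | A j), P j E]) <= \sum_(j | A j) prob (P j).
Proof.
rewrite /prob /expct exchange_big /=; apply: ler_sum => E _.
rewrite -mulr_sumr ler_wpM2l ?wt_ge0 //.
case: existsP => [[j /andP [Aj Pj]]|_]; last by apply: sumr_ge0.
rewrite (bigD1 j) //= Pj lerDl; exact: sumr_ge0.
Qed.

Lemma prob_negb P : prob (fun E => ~~ P E) = 1 - prob P.
Proof.
have -> : 1 = prob P + prob (fun E => ~~ P E).
  by rewrite -expctD -[LHS](expct_cst 1); apply: eq_expct => E; case: (P E); rewrite ?addr0 ?add0r.
by rewrite addrAC subrr add0r.
Qed.

(* Swapping the [D]-parts of two independent copies preserves the product weight. *)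
Lemma expct_resample D f :
  expct (fun E' => expct (fun E => f ((E :&: D) :|: (E' :\: D)))) = expct f.
Proof.
pose sw (p : {set I} * {set I}) :=
  ((p.1 :&: D) :|: (p.2 :\: D), (p.2 :&: D) :|: (p.1 :\: D)).
have swK : involutive sw.
  move=> [E E']; rewrite /sw /=; congr pair; apply/setP => i; rewrite !inE;
  by case: (i \in D); case: (i \in E); case: (i \in E').
have wsw p : wt (sw p).1 * wt (sw p).2 = wt p.1 * wt p.2.
  rewrite /wt -!big_split /=; apply: eq_bigr => i _; rewrite !inE.
  by case: (i \in D); rewrite ?(andbF, andbT, orbF) //= mulrC.
rewrite /expct.
transitivity (\sum_(p : {set I} * {set I}) wt p.1 * wt p.2 * f (sw p).1).
  rewrite -(pair_big xpredT xpredT (fun E E' => wt E * wt E' * f (sw (E, E')).1)).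
  rewrite exchange_big /=; apply: eq_bigr => E _; rewrite mulr_sumr.
  by apply: eq_bigr => E' _; ring.
rewrite (reindex_inj (inv_inj swK)).
under eq_bigr => p _ do rewrite wsw swK.
rewrite -(pair_big xpredT xpredT (fun E E' => wt E * wt E' * f E)) /=.
apply: eq_bigr => E _; rewrite -mulr_suml -mulr_sumr wt_sum1; ring.
Qed.

(** After resampling, [f] reads only the copy inside [D] and [g] only the copy outside, so the
    double expectation splits. *)
Lemma expct_indep D f g :
  (forall E, f E = f (E :&: D)) -> (forall E, g E = g (E :\: D)) ->
  expct (fun E => f E * g E) = expct f * expct g.
Proof.
move=> fD gD; rewrite -[LHS](expct_resample D).
rewrite -[RHS]expctMl; apply: eq_expct => E'.
rewrite [RHS]mulrC -[RHS]expctMl; apply: eq_expct => E.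
rewrite fD gD [RHS]mulrC; congr (_ * _).
  rewrite [RHS]fD; congr f; apply/setP => i; rewrite !inE.
  by case: (i \in D); rewrite ?(andbF, andbT, orbF).
by rewrite [RHS]gD; congr g; apply/setP => i; rewrite !inE; case: (i \in D); rewrite /= ?andbF.
Qed.

(* [E'] reveals the edges outside [D], then [E] those inside. *)
Lemma prob_expose D P Q (delta : R) : 0 <= delta ->
  (forall E', P E' -> prob (fun E => ~~ Q ((E :&: D) :|: (E' :\: D))) <= delta) ->
  prob (fun E => ~~ Q E) <= prob (fun E => ~~ P E) + delta.
Proof.
move=> d0 PQ; rewrite {1}/prob -(expct_resample D).
rewrite -(expct_cst delta) -expctD; apply: le_expct => E'.
case: (boolP (P E')) => PE' /=; first by rewrite add0r; apply: PQ.
by have := prob_le1 (fun E => ~~ Q ((E :&: D) :|: (E' :\: D))); rewrite /prob; lra.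
Qed.

Lemma prob_disjoint F : prob (fun E => [disjoint E & F]) = (1 - q) ^+ #|F|.
Proof.
(* The indicator is absorbed into the factors: an element of [F] weighs 0 when it is kept. The sum
   over sets is then again a product. *)
transitivity (\sum_(E : {set I}) \prod_i (if i \in E then q * (i \notin F)%:R else 1 - q)).
  apply: eq_bigr => E _; case: (boolP [disjoint E & F]) => dEF.
    rewrite mulr1; apply: eq_bigr => i _; case: ifP => // iE.
    by rewrite (disjointFr dEF iE) mulr1.
  rewrite mulr0; move: dEF; rewrite -setI_eq0 => /set0Pn [i].
  by rewrite inE => /andP [iE iF]; rewrite (bigD1 i) //= iE iF mulr0 mul0r.
rewrite -(bigA_distr _ _ (fun i => q * (i \notin F)%:R) (fun=> 1 - q)).
rewrite (bigID (mem F)) /= -[RHS]mulr1 -prodr_const; congr (_ * _).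
  by apply: eq_bigr => i ->; rewrite /= mulr0 add0r.
by rewrite big1 // => i ->; rewrite /= mulr1 addrC subrK.
Qed.

Lemma prob_subset F : prob (fun E => F \subset E) = q ^+ #|F|.
Proof.
transitivity (\sum_(E : {set I}) \prod_i (if i \in E then q else (1 - q) * (i \notin F)%:R)).
  apply: eq_bigr => E _; case: (boolP (F \subset E)) => sFE.
    rewrite mulr1; apply: eq_bigr => i _; case: ifP => // iE.
    case: (boolP (i \in F)) => iF; last by rewrite mulr1.
    by rewrite (subsetP sFE) in iE.
  rewrite mulr0; case/subsetPn: sFE => i iF /negbTE iE.
  by rewrite (bigD1 i) //= iE iF mulr0 mul0r.
rewrite -(bigA_distr _ _ (fun=> q) (fun i => (1 - q) * (i \notin F)%:R)).
rewrite (bigID (mem F)) /= -[RHS]mulr1 -prodr_const; congr (_ * _).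
  by apply: eq_bigr => i ->; rewrite /= mulr0 addr0.
by rewrite big1 // => i ->; rewrite /= mulr1 addrC subrK.
Qed.

Lemma expr_1Bx_le (x : R) k : x <= 1 -> (1 - x) ^+ k <= expR (- (k%:R * x)).
Proof.
move=> x1; rewrite -mulrN expRM_natl lerXn2r ?nnegrE ?subr_ge0 ?expR_ge0 //.
exact: expR_ge1Dx.
Qed.

(** Induction on [s]: the head depends on [B w] only, the remaining product on the complement of
    [B w], and [expct_indep] separates them. *)
Lemma expct_prod_indep (T : eqType) (s : seq T) (f : T -> {set I} -> R)
    (B : T -> {set I}) : uniq s ->
  {in s, forall w E, f w E = f w (E :&: B w)} ->
  {in s &, forall w w', w != w' -> [disjoint B w & B w']} ->
  expct (fun E => \prod_(w <- s) f w E) = \prod_(w <- s) expct (f w).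
Proof.
elim: s => [|w s IH] /=.
  by move=> _ _ _; rewrite big_nil -{2}(expct_cst 1); apply: eq_expct => E; rewrite big_nil.
case/andP=> ws us fB dB; rewrite big_cons -IH //; first last.
- by move=> v v' vs v's; apply: dB; rewrite inE ?vs ?v's orbT.
- by move=> v vs; apply: fB; rewrite inE vs orbT.
rewrite -(@expct_indep (B w)).
- by apply: eq_expct => E; rewrite big_cons.
- by apply: fB; rewrite mem_head.
move=> E; rewrite !big_seq; apply: eq_bigr => v vs.
have vws : v \in w :: s by rewrite inE vs orbT.
rewrite fB // [RHS]fB //; congr f; apply/setP => i; rewrite !inE.
case: (boolP (i \in B v)) => iv; rewrite ?andbF ?andbT //.
rewrite (disjointFl (dB w v _ _ _) iv) ?mem_head //.
by apply: contraNneq ws => ->.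
Qed.

(** From the probability of missing [G] one subtracts that of missing both sets, where the exponents
    add by disjointness. *)
Lemma prob_hit_miss F (G : {set I}) : [disjoint F & G] ->
  (1 - q) ^+ #|G| * (1 - (1 - q) ^+ #|F|)
    <= prob (fun E => ~~ [disjoint E & F] && [disjoint E & G]).
Proof.
move=> dFG; rewrite mulrBr mulr1 -exprD -cardsUI.
have -> : G :&: F = set0 by apply/eqP; rewrite setI_eq0 disjoint_sym.
rewrite cards0 addn0 -!prob_disjoint lerBlDr; apply: le_trans (probU _ _).
apply: le_prob => E dG; rewrite dG andbT -!setI_eq0 setIUr setU_eq0.
by rewrite !setI_eq0 dG /=; case: [disjoint E & F].
Qed.

(* Lower tail by Markov's inequality for [2 ^ -X]. *)
Lemma chernoff_lower (T : finType) (W : {set T}) (ev : T -> pred {set I})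
    (B : T -> {set I}) (rho : R) (t : nat) :
  {in W, forall w E, ev w E = ev w (E :&: B w)} ->
  {in W &, forall w w', w != w' -> [disjoint B w & B w']} ->
  {in W, forall w, rho <= prob (ev w)} -> 0 <= rho <= 1 ->
  t%:R <= rho * #|W|%:R / 4 ->
  prob (fun E => (#|[set w in W | ev w E]| <= t)%N)
    <= expR (- (rho * #|W|%:R / 4)).
Proof.
move=> evB dB evrho rho01 tW.
pose f w E : R := if ev w E then 2^-1 else 1.
have prodE E : \prod_(w <- enum W) f w E = 2^-1 ^+ #|[set w in W | ev w E]|.
  rewrite big_enum /= -big_mkcondr /= -[RHS]prodr_const /=.
  by apply: eq_bigl => w; rewrite !inE.
have expf w : w \in W -> expct (f w) <= 1 - rho / 2.
  move=> wW; have -> : expct (f w) = 1 - 2^-1 * prob (ev w).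
    rewrite -expctMl -[X in _ = X - _](expct_cst 1).
    rewrite -[LHS]opprK -[RHS]opprK; congr (- _).
    rewrite opprB [LHS](_ : _ = expct (fun E => (-1) * f w E)); last by rewrite expctMl; lra.
    rewrite [X in _ = _ - X](_ : _ = - expct (fun=> -1)); last by rewrite !expct_cst opprK.
    rewrite opprK -expctD; apply: eq_expct => E; rewrite /f.
    by case: (ev w E) => /=; lra.
  have := evrho w wW; lra.
have prod_le : expct (fun E => \prod_(w <- enum W) f w E) <= expR (- (rho * #|W|%:R / 2)).
  rewrite (@expct_prod_indep _ _ _ B) ?enum_uniq //; first last.
  - by move=> w w'; rewrite !mem_enum; apply: dB.
  - by move=> w; rewrite mem_enum => wW E; rewrite /f evB.
  rewrite big_enum /=.
  apply: le_trans (_ : \prod_(w in W) (1 - rho / 2) <= _).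
    apply: ler_prod => w wW; rewrite expf // andbT; apply: expct_ge0 => E.
    by rewrite /f; case: ifP => _; lra.
  rewrite prodr_const; apply: le_trans (expr_1Bx_le _ _) _; first lra.
  by rewrite ler_expR; lra.
(* The Markov factor [2 ^+ t] is at most [expR t]; by the hypothesis on [t] it consumes at most half
   of the exponent [rho * #|W| / 2]. *)
have two_e := exp2_le_expR R t.
apply: le_trans (_ : 2 ^+ t * expct (fun E => \prod_(w <- enum W) f w E) <= _).
  rewrite -expctMl; apply: le_expct => E; rewrite prodE.
  case: leqP => Et /=; last by rewrite mulr_ge0 ?exprn_ge0 // invr_ge0.
  apply: le_trans (_ : 2 ^+ t * 2^-1 ^+ t <= _).
    by rewrite -exprMn mulfV ?expr1n // pnatr_eq0.
  rewrite ler_wpM2l ?exprn_ge0 // ler_wiXn2l //; lra.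
apply: le_trans (ler_pM _ _ two_e prod_le) _.
- by rewrite exprn_ge0.
- by apply: expct_ge0 => E; rewrite prodE exprn_ge0 // invr_ge0.
by rewrite -expRD ler_expR; lra.
Qed.

End RandomSubset.

(** * Block partitions and greedy matchings *)

Section Combinatorics.

Lemma subset_of_card (T : finType) (X : {set T}) k : (k <= #|X|)%N ->
  exists2 Y : {set T}, Y \subset X & #|Y| = k.
Proof.
move=> /card_geqP [l [ul <- lX]]; exists [set v in l].
  by apply/subsetP => v; rewrite inE => /lX.
by rewrite cardsE; apply/card_uniqP.
Qed.

(** The parts are consecutive runs of length [s] in an enumeration; quotient and remainder of a
    position by [s] recover the part and the rank, whence disjointness. *)
Lemma equipartition (T : finType) (X : {set T}) K s : (K * s <= #|X|)%N ->
  exists A : 'I_K -> {set T},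
    [/\ forall i, A i \subset X, forall i, #|A i| = s &
        forall i i', i != i' -> [disjoint A i & A i']].
Proof.
move=> KsX.
have bnd (i : 'I_K) (r : 'I_s) : (i * s + r < K * s)%N.
  apply: leq_trans (_ : i.+1 * s <= _)%N; last by rewrite leq_mul2r ltn_ord orbT.
  by rewrite mulSn addnC ltn_add2r ltn_ord.
(* The empty case is separate because [nth] needs a default element. *)
have [|x0] := posnP (K * s).
  move=> /eqP; rewrite muln_eq0 => K0s0.
  exists (fun=> set0); split=> [i|i|i i' _]; first exact: sub0set.
    by case/orP: K0s0 => /eqP E0; [case: i; rewrite E0 | rewrite cards0 E0].
  by rewrite -setI_eq0 set0I.
case/card_geqP: KsX => l [ul sl lX].
have [v0 _] : exists v, v \in l by case: l sl {ul lX} => [/= E0|v l _]; [rewrite -E0 in x0 | exists v; rewrite mem_head].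
pose g (i : 'I_K) (r : 'I_s) := nth v0 l (i * s + r).
have gi i i' r r' : g i r = g i' r' -> i = i' /\ r = r'.
  move=> /eqP; rewrite nth_uniq ?sl ?bnd // => /eqP e.
  have s0 : (0 < s)%N by apply: leq_ltn_trans (ltn_ord r).
  split; apply: val_inj => /=.
    by have := congr1 (divn^~ s) e; rewrite !divnMDl // !divn_small // !addn0.
  by have := congr1 (modn^~ s) e; rewrite !modnMDl !modn_small.
exists (fun i => [set g i r | r : 'I_s]); split.
- move=> i; apply/subsetP => _ /imsetP [r _ ->]; apply: lX.
  by rewrite mem_nth // sl bnd.
- by move=> i; rewrite card_imset ?card_ord // => r r' /gi [].
move=> i i'; apply: contraNT; rewrite -setI_eq0 => /set0Pn [v].
by rewrite inE => /andP [/imsetP [r _ ->] /imsetP [r' _ /gi [->]]].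
Qed.

Lemma greedy_matching K k (M : rel 'I_K) : (2 * k <= K)%N ->
  (forall S S' : {set 'I_K}, (K <= 2 * #|S|)%N -> (K <= 2 * #|S'|)%N ->
     exists i j, [/\ i \in S, j \in S' & M i j]) ->
  exists l : seq ('I_K * 'I_K),
    [/\ size l = k, all (fun p => M p.1 p.2) l, uniq (unzip1 l) & uniq (unzip2 l)].
Proof.
move=> kK hM; elim: k kK => [|k IH] kK; first by exists [::].
have [|l [sl Ml u1 u2]] := IH; first by lia.
have big (l' : seq 'I_K) : size l' = k -> (K <= 2 * #|[set i | i \notin l']|)%N.
  move=> sl'; have := cardsC [set i in l']; rewrite card_ord.
  have -> : ~: [set i in l'] = [set i | i \notin l'] by apply/setP => i; rewrite !inE.
  have : (#|[set i in l']| <= size l')%N by rewrite cardsE card_size.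
  lia.
have [||i [j [iS jS Mij]]] := hM [set i | i \notin unzip1 l] [set i | i \notin unzip2 l].
- by apply: big; rewrite size_map.
- by apply: big; rewrite size_map.
move: iS jS; rewrite !inE => iS jS.
by exists ((i, j) :: l); rewrite /= Mij sl iS jS.
Qed.

End Combinatorics.

(** * Branches of disjoint paths in a bipartite graph *)

Section Graph.
Variables m n : nat.
Implicit Types (E : {set 'I_m * 'I_n}) (X Y Z Zx Zy W Wx Wy : {set vtx m n}) (x y v w : vtx m n).

Definition in_left v : bool := if v is inl _ then true else false.

Definition between X Y : {set 'I_m * 'I_n} :=
  [set e | (inl e.1 \in X) && (inr e.2 \in Y) || (inl e.1 \in Y) && (inr e.2 \in X)].

Definition inside Z : {set 'I_m * 'I_n} := [set e | (inl e.1 \in Z) && (inr e.2 \in Z)].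

Lemma adjC E x y : adj E x y = adj E y x.
Proof. by case: x; case: y. Qed.

Lemma sub_adj E E' x y : E \subset E' -> adj E x y -> adj E' x y.
Proof. by move=> /subsetP s; case: x; case: y => //= ? ?; apply: s. Qed.

Lemma betweenC X Y : between X Y = between Y X.
Proof. by apply/setP => e; rewrite !inE orbC. Qed.

Lemma betweenP E X Y :
  reflect (exists v w, [/\ v \in X, w \in Y & adj E v w]) (~~ [disjoint E & between X Y]).
Proof.
rewrite -setI_eq0; apply: (iffP (set0Pn _)) => [[[u w]]|[v [w [vX wY]]]].
  rewrite !inE /= => /andP [eE] /orP [] /andP [h1 h2].
    by exists (inl u), (inr w).
  by exists (inr w), (inl u).
case: v w vX wY => [u|u] [w|w] //= h1 h2 eE.
  by exists (u, w); rewrite !inE eE /= h1 h2.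
by exists (w, u); rewrite !inE eE /= h1 h2 orbT.
Qed.

Lemma card_between s X Y : {in X, forall v, in_left v = s} ->
  {in Y, forall v, in_left v = ~~ s} -> #|between X Y| = (#|X| * #|Y|)%N.
Proof.
wlog -> : s X Y / s = true.
  case: s => hw hX hY; first exact: (hw true).
  by rewrite betweenC mulnC; apply: (hw true).
move=> hX hY.
have -> : between X Y = setX [set u | inl u \in X] [set w | inr w \in Y].
  apply/setP => -[u w]; rewrite !inE /=; case: (boolP (inr w \in X)) => [/hX //|_].
  by rewrite andbF orbF.
rewrite cardsX; congr (_ * _)%N.
  rewrite -(card_imset _ (@inl_inj 'I_m 'I_n)); congr #|pred_of_set _|; apply/setP => v.
  apply/imsetP/idP => [[u]|]; first by rewrite inE => h ->.
  by case: v => [u|u] vX; [exists u; rewrite ?inE | have := hX _ vX].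
rewrite -(card_imset _ (@inr_inj 'I_m 'I_n)); congr #|pred_of_set _|; apply/setP => v.
apply/imsetP/idP => [[u]|]; first by rewrite inE => h ->.
by case: v => [u|u] vY; [have := hY _ vY | exists u; rewrite ?inE].
Qed.

(** Different candidates for the next level look at different edges; this supplies the disjoint
    supports required by [chernoff_lower]. *)
Lemma disjoint_between X w w' : w != w' -> w' \notin X ->
  [disjoint between [set w] X & between [set w'] X].
Proof.
move=> ww' w'X; rewrite -setI_eq0; apply/set0Pn => -[e].
rewrite !inE => /andP [] /orP [] /andP [h1 h2] /orP [] /andP [h3 h4].
- by rewrite -(eqP h1) -(eqP h3) eqxx in ww'.
- by rewrite -(eqP h4) h2 in w'X.
- by rewrite -(eqP h3) h1 in w'X.
- by rewrite -(eqP h2) -(eqP h4) eqxx in ww'.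
Qed.

Definition reach E x (T : {set vtx m n}) j v : Prop :=
  exists p, [/\ size p = j, path (adj E) x p, last x p = v, uniq (x :: p) & all (mem T) p].

(* [A i] is the set of tips of branch [i] and [T i] all its vertices; [W] is the
   current level and [Z] the set of vertices used so far. *)
Definition branches E x Z W K j s (A T : 'I_K -> {set vtx m n}) : Prop :=
  [/\ forall i, A i \subset T i :&: W, forall i, #|A i| = s,
      forall i, T i \subset Z :\ x,
      forall i i', i != i' -> [disjoint T i & T i'] &
      forall i v, v \in A i -> reach E x (T i) j v].

Definition grown E x Z W K j s : Prop := exists A T, @branches E x Z W K j s A T.

Lemma reach_step E E' x (T T' : {set vtx m n}) j v w :
  E \subset E' -> T \subset T' -> w \in T' -> w \notin T -> w != x ->
  adj E' v w -> reach E x T j v -> reach E' x T' j.+1 w.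
Proof.
move=> sE sT wT' wT wx avw [p [sp pp lp up Tp]]; exists (rcons p w).
rewrite size_rcons sp rcons_path last_rcons lp avw andbT all_rcons /= wT'.
have Tp' : all (mem T') p by apply: sub_all Tp => z; exact: (subsetP sT).
rewrite Tp'; split=> //; first by apply: sub_path pp => a b; exact: sub_adj.
move: up => /= /andP [xp up]; rewrite mem_rcons inE (eq_sym x) (negbTE wx) /= xp.
rewrite rcons_uniq up andbT; apply: contra wT; exact: (allP Tp).
Qed.

(** An edge leaving [Z] is not among the exposed ones, so it is read off the fresh sample [E], and
    it lies inside the enlarged zone. *)
Lemma adj_new E E' Z W v w : v \in Z -> w \in W -> w \notin Z -> adj E v w ->
  adj (((E :&: ~: inside Z) :|: (E' :\: ~: inside Z)) :&: inside (Z :|: W)) v w.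
Proof.
by case: v w => [u|u] [w|w] //= h1 h2 h3 h4; rewrite !inE /= h1 h2 h4 (negbTE h3) ?andbF ?orbT.
Qed.

(** The path climbs from [x] to [v], crosses the edge to [w], and descends along the reversed branch
    to [y]; reversing [y :: r] puts [w] first and [y] last. *)
Lemma reach_glue E x y (Tx Ty : {set vtx m n}) jx jy v w :
  x \notin Tx -> y \notin Ty -> x \notin Ty -> y \notin Tx -> x != y ->
  [disjoint Tx & Ty] -> reach E x Tx jx v -> reach E y Ty jy w -> adj E v w ->
  exists s, is_path_len E (jx + jy).+1 x y s /\
    {subset interior y s <= Tx :|: Ty}.
Proof.
move=> xx yy xy yx nxy dT [p [sp pp lp up Tp]] [r [sr pr lr ur Tr]] avw.
exists (p ++ rev (y :: r)); split; last first.
  move=> z; rewrite mem_filter mem_cat mem_rev !inE => /andP [/negbTE -> /=].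
  by case/orP => [/(allP Tp)|/(allP Tr)] /= ->; rewrite ?orbT.
have er : rev (y :: r) = w :: rev (belast y r) by rewrite lastI lr rev_rcons.
rewrite /is_path_len size_cat size_rev /= sp sr addnS eqxx cat_path pp er /= lp avw /=.
rewrite -{1}lr rev_path (eq_path (e' := adj E)) ?pr => [|a b]; last exact: adjC.
rewrite -er last_cat rev_cons last_rcons eqxx /= -rev_cons.
rewrite cat_uniq mem_cat mem_rev inE rev_uniq ur /= negb_or (negbTE nxy) /=.
move: up => /= /andP [-> ->]; rewrite andbT /=; apply/andP; split.
  by apply: contra xy; exact: (allP Tr).
apply/hasPn => z; rewrite mem_rev inE => zyr; apply/negP => zp.
have zT : z \in Tx := allP Tp _ zp.
case/orP: zyr => [/eqP ez|/(allP Tr) /= zT']; first by rewrite -ez zT in yx.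
by have := disjointFr dT zT; rewrite zT'.
Qed.

(** [greedy_matching] is applied to the relation telling that tips of branch [i] of [x] and branch
    [j] of [y] span an edge. Matched pairs use different branches on both sides, hence disjoint
    interiors. *)
Lemma many_disjoint_paths_of_branches (R : realType) E x y Zx Wx Zy Wy K k jx jy sx sy
    (Ax Tx Ay Ty : 'I_K -> {set vtx m n}) (b : R) :
  x \in Zx -> y \in Zy -> [disjoint Zx & Zy] -> (2 * k <= K)%N -> b <= k%:R ->
  @branches E x Zx Wx K jx sx Ax Tx -> @branches E y Zy Wy K jy sy Ay Ty ->
  (forall S S' : {set 'I_K}, (K <= 2 * #|S|)%N -> (K <= 2 * #|S'|)%N ->
    ~~ [disjoint E & between (\bigcup_(i in S) Ax i) (\bigcup_(i in S') Ay i)]) ->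
  many_disjoint_paths E (jx + jy).+1 x y b.
Proof.
move=> xZ yZ dZ kK bk [_ _ TxZ dTx rx] [_ _ TyZ dTy ry] hM.
pose M (i j : 'I_K) := ~~ [disjoint E & between (Ax i) (Ay j)].
have [l [sl Ml u1 u2]] : exists l : seq ('I_K * 'I_K),
    [/\ size l = k, all (fun p => M p.1 p.2) l, uniq (unzip1 l) & uniq (unzip2 l)].
  apply: greedy_matching kK _ => S S' hS hS'.
  have /betweenP [v [w [/bigcupP [i iS vi] /bigcupP [j jS wj] avw]]] := hM S S' hS hS'.
  by exists i, j; split=> //; apply/betweenP; exists v, w.
have sTxZ i : Tx i \subset Zx by apply: subset_trans (TxZ i) _; exact: subsetDl.
have sTyZ i : Ty i \subset Zy by apply: subset_trans (TyZ i) _; exact: subsetDl.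
have dTxy i j : [disjoint Tx i & Ty j].
  by apply: disjointWl (sTxZ i) _; apply: disjointWr (sTyZ j) _.
(* The matching condition stays under the existential, with a dummy path for unmatched pairs, so
   that choice gives a function on all pairs. *)
have hp (ij : 'I_K * 'I_K) : exists s, M ij.1 ij.2 ->
    is_path_len E (jx + jy).+1 x y s /\ {subset interior y s <= Tx ij.1 :|: Ty ij.2}.
  case: (boolP (M ij.1 ij.2)) => [/betweenP [v [w [/rx rv /ry rw avw]]]|_]; last by exists [::].
  have [|||||| s hs] := reach_glue _ _ _ _ _ _ rv rw avw; last by exists s.
  - by apply/negP => /(subsetP (TxZ _)); rewrite !inE eqxx.
  - by apply/negP => /(subsetP (TyZ _)); rewrite !inE eqxx.
  - by apply/negP => /(subsetP (sTyZ _)); rewrite (disjointFr dZ).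
  - by apply/negP => /(subsetP (sTxZ _)); rewrite (disjointFl dZ).
  - by apply/negP => /eqP exy; have := disjointFr dZ xZ; rewrite exy yZ.
  - exact: dTxy.
have [f hf] := boolp.choice hp.
exists [seq f ij | ij <- l]; rewrite size_map sl; split=> //.
  rewrite all_map; apply: sub_all Ml => ij /hf [] //.
rewrite pairwise_map.
move: u1 u2; rewrite !uniq_pairwise !pairwise_map => u1 u2.
(* Distinct first entries and distinct second entries are merged into one pairwise relation, from
   which disjointness is derived. *)
have := pairwise_relI (relpre fst (fun a b : 'I_K => a != b)) (relpre snd (fun a b : 'I_K => a != b)) l.
rewrite u1 u2 /=; apply: (sub_in_pairwise (P := fun p => M p.1 p.2)) Ml.
move=> [i j] [i' j'] /hf [_ hs] /hf [_ hs'] /= /andP [ii' jj'].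
apply/hasPn => v /hs vs; apply/negP => /hs' vs'.
move: vs vs'; rewrite !inE => /orP [] h1 /orP [] h2.
- by rewrite (disjointFr (dTx _ _ ii') h1) in h2.
- by rewrite (disjointFr (dTxy _ _) h1) in h2.
- by rewrite (disjointFl (dTxy _ _) h1) in h2.
- by rewrite (disjointFr (dTy _ _ jj') h1) in h2.
Qed.

End Graph.

(** * Exposing the edges level by level *)

Section Exposure.
Variables (R : realType) (m n : nat) (q : R).
Hypothesis q01 : 0 <= q <= 1.
Implicit Types (E : {set 'I_m * 'I_n}) (X Y Z Zx Zy W Wx Wy : {set vtx m n}) (x y v w : vtx m n).

Let q_ge0 : 0 <= q. Proof. by case/andP: q01. Qed.
Let q_le1 : q <= 1. Proof. by case/andP: q01. Qed.

Lemma card_bigcup_disjoint K s (A : 'I_K -> {set vtx m n}) (S : {set 'I_K}) :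
  (forall i, #|A i| = s) -> (forall i i', i != i' -> [disjoint A i & A i']) ->
  #|\bigcup_(i in S) A i| = (#|S| * s)%N.
Proof.
move=> cA dA; rewrite big_mkcond /= -sum1_card partition_disjoint_bigcup.
  rewrite -sum_nat_const [RHS]big_mkcond /=; apply: eq_bigr => i _.
  by case: ifP => _; rewrite sum1_card ?cA ?cards0.
move=> i j ij; rewrite -setI_eq0; case: ifP => _; rewrite ?set0I //.
by case: ifP => _; rewrite ?setI0 // setI_eq0 dA.
Qed.

(** Each vertex of [W] is adjacent to [x] independently with probability [q]; more than [K * s]
    neighbours can be cut into [K] groups of size [s]. *)
Lemma prob_not_grown_start x W K s :
  {in W, forall w, in_left w = ~~ in_left x} -> (K * s)%:R <= q * #|W|%:R / 4 ->
  prob q (fun E => ~~ `[< grown (E :&: inside (x |: W)) x (x |: W) W K 1 s >])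
    <= expR (- (q * #|W|%:R / 4)).
Proof.
move=> sW KsW; pose B w := between [set w] [set x].
have xW : x \notin W by apply/negP => /sW; case: (in_left x).
pose ev w E := ~~ [disjoint E & B w].
apply: le_trans (_ : prob q (fun E => (#|[set w in W | ev w E]| <= K * s)%N) <= _).
  apply: le_prob => // E; apply: contraNT; rewrite -ltnNge => /ltnW.
  case/equipartition => A [AX cA dA]; apply/asboolP; exists A, A; split=> //.
  - move=> i; rewrite subsetI subxx /=; apply/subsetP => w /(subsetP (AX i)).
    by rewrite inE => /andP [].
  - move=> i; apply/subsetP => w /(subsetP (AX i)); rewrite !inE => /andP [wW _].
    by rewrite wW orbT andbT; apply: contraNneq xW => <-.
  move=> i v vA; have := subsetP (AX i) _ vA; rewrite inE => /andP [vW].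
  case/betweenP => v' [x' [/set1P -> /set1P -> avx]]; exists [:: v].
  split; rewrite //= ?vA // ?andbT; last by rewrite inE; apply: contraNneq xW => ->.
  rewrite adjC; case: v x avx vW {vA xW sW KsW AX ev B} => [u|u] [w|w] //=;
  by rewrite !inE /= => -> ->; rewrite ?eqxx ?orbT.
apply: (chernoff_lower q01 (B := B)) => //.
- by move=> w _ E; rewrite /ev -!setI_eq0 -setIA setIid.
- move=> w w' _ w'W ww'; apply: disjoint_between => //.
  by rewrite inE; apply: contraNneq xW => <-.
move=> w wW; rewrite prob_negb // prob_disjoint // (card_between (s := in_left w)).
- by rewrite !cards1 muln1 expr1 subKr lexx.
- by move=> v /set1P ->.
by move=> v /set1P ->; rewrite (sW w) ?negbK.
Qed.

(** With the edges inside [Z] revealed and the groups fixed, a fresh vertex joins group [i] with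
    probability at least [q * s / 4]. The Chernoff bound applies to each group, and a union bound
    over the [K] groups gives the added term. *)
Lemma prob_not_grown_step x Z W W' K j s t side :
  x \in Z -> [disjoint W & Z] ->
  {in W', forall w, in_left w = side} -> {in W, forall w, in_left w = ~~ side} ->
  q * (K * s)%:R <= 2^-1 -> t%:R <= q * s%:R * #|W|%:R / 16 ->
  prob q (fun E => ~~ `[< grown (E :&: inside (Z :|: W)) x (Z :|: W) W K j.+1 t >])
    <= prob q (fun E => ~~ `[< grown (E :&: inside Z) x Z W' K j s >])
       + K%:R * expR (- (q * s%:R * #|W|%:R / 16)).
Proof.
move=> xZ dWZ sW' sW qKs tW.
apply: (prob_expose q01 (D := ~: inside Z)); first by rewrite mulr_ge0 ?expR_ge0.
move=> E' /asboolP [A [T [ATW cA TZ dT rA]]].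
have AT i : A i \subset T i by apply: subset_trans (ATW i) (subsetIl _ _).
have AW' i : A i \subset W' by apply: subset_trans (ATW i) (subsetIr _ _).
have TZ' i : T i \subset Z by apply: subset_trans (TZ i) (subsetDl _ _).
have dA i i' : i != i' -> [disjoint A i & A i'].
  by move=> ii'; apply: disjointWl (AT i) _; apply: disjointWr (AT i') (dT _ _ ii').
pose Ac i := \bigcup_(i' in [set~ i]) A i'.
pose U := \bigcup_(i in [set: 'I_K]) A i.
have UW' : U \subset W' by apply/bigcupsP.
have UZ : U \subset Z by apply/bigcupsP => i _; apply: subset_trans (AT i) (TZ' i).
have AU i : A i \subset U by apply: bigcup_sup; rewrite inE.
have AcU i : Ac i \subset U by apply/bigcupsP => i' _; apply: AU.
pose B w := between [set w] U.
(* Missing all other groups makes the new groups disjoint. For every [i] the event depends only on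
   the edges from [w] to the union [U] of all tips. *)
pose ev i w E := ~~ [disjoint E & between [set w] (A i)] && [disjoint E & between [set w] (Ac i)].
have WZ w : w \in W -> w \notin Z by move=> wW; rewrite (disjointFr dWZ).
apply: le_trans (_ : prob q (fun E => [exists (i : 'I_K | true), (#|[set w in W | ev i w E]| <= t)%N]) <= _).
  apply: le_prob => // E; apply: contraNT => /existsPn hE; apply/asboolP.
  have hA' i : exists A' : {set vtx m n}, A' \subset [set w in W | ev i w E] /\ #|A'| = t.
    have := hE i; rewrite /= -ltnNge => /ltnW /subset_of_card [A' sA' <-].
    by exists A'.
  have [A' hA'i] := boolp.choice hA'.
  have A'W i : A' i \subset W.
    by apply: subset_trans (hA'i i).1 _; apply/subsetP => w; rewrite inE => /andP [].
  have A'ev i w : w \in A' i -> ev i w E.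
    by move=> /(subsetP (hA'i i).1); rewrite inE => /andP [].
  exists A', (fun i => T i :|: A' i); split.
  - by move=> i; rewrite subsetI subsetUr A'W.
  - by move=> i; case: (hA'i i).
  - move=> i; apply/subsetP => w; rewrite !inE => /orP [/(subsetP (TZ i))|/(subsetP (A'W i)) wW].
      by rewrite !inE => /andP [-> ->].
    by rewrite wW orbT andbT; apply: contraNneq (WZ _ wW) => ->.
  - move=> i i' ii'; have TA k l : [disjoint T k & A' l].
      rewrite disjoint_sym; apply: disjointWl (A'W l) _.
      by apply: disjointWr (TZ' k) dWZ.
    rewrite -setI_eq0 setIUl !setIUr !setU_eq0 !setI_eq0 dT // !TA.
    (* A vertex in two new groups would be adjacent to [A i], which its membership in group [i']
       forbids. *)
    rewrite [X in _ && (X && _)]disjoint_sym TA /= -setI_eq0; apply/set0Pn => -[w].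
    rewrite inE => /andP [/A'ev /andP [hi _] /A'ev /andP [_ hi']].
    case/betweenP: hi => w' [a [ww' aA aw]].
    suff : ~~ [disjoint E & between [set w] (Ac i')] by rewrite hi'.
    apply/betweenP; exists w', a; split=> //.
    by apply/bigcupP; exists i; rewrite // !inE.
  move=> i w wA'; have wW := subsetP (A'W i) _ wA'.
  have /andP [/betweenP [w' [a [/set1P -> aA aw]]] _] := A'ev _ _ wA'.
  have aZ : a \in Z by apply: (subsetP (TZ' i)); apply: (subsetP (AT i)).
  apply: reach_step (rA i a aA).
  - apply/subsetP => e; rewrite !inE negbK => /andP [-> /andP [-> ->]].
    by rewrite !orbT.
  - exact: subsetUl.
  - by rewrite inE wA' orbT.
  - by apply: contra (WZ _ wW) => /(subsetP (TZ' i)).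
  - by apply: contraNneq (WZ _ wW) => ->.
  by apply: adj_new => //; [exact: WZ | rewrite adjC].
apply: le_trans (prob_exists q01 _ _) _.
apply: le_trans (_ : \sum_(i < K) expR (- (q * s%:R * #|W|%:R / 16)) <= _); last first.
  by rewrite sumr_const card_ord mulr_natl.
apply: ler_sum => i _.
have sbet w Y Y' : Y \subset Y' -> between [set w] Y \subset between [set w] Y'.
  move=> /subsetP sY; apply/subsetP => e; rewrite !inE.
  by case/orP => /andP [h1 h2]; [rewrite h1 (sY _ h2) | rewrite h2 (sY _ h1) orbT].
have cb w Y : w \in W -> Y \subset U -> #|between [set w] Y| = #|Y|.
  move=> wW YU; rewrite (card_between (s := ~~ side)) ?cards1 ?mul1n //.
    by move=> v /set1P ->; exact: sW.
  by move=> v vY; rewrite negbK; apply: sW'; apply: (subsetP UW'); apply: (subsetP YU).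
have s_le : (s <= K * s)%N by rewrite leq_pmull //; case: (i) => k; exact: leq_trans.
have qs : q * s%:R <= 2^-1 by apply: le_trans qKs; rewrite ler_wpM2l // ler_nat.
(* Success probability [q * s / 4]: a factor 1/2 for missing the other groups and [q * s / 2] for
   hitting its own. *)
have -> : q * s%:R * #|W|%:R / 16 = (q * s%:R / 4) * #|W|%:R / 4 by field.
apply: (chernoff_lower q01 (B := B)).
- have dis E w Y : Y \subset U ->
    [disjoint E :&: B w & between [set w] Y] = [disjoint E & between [set w] Y].
    by move=> YU; rewrite -!setI_eq0 -setIA (setIidPr (sbet w _ _ YU)).
  by move=> w _ E; rewrite /ev !dis.
- move=> w w' _ w'W ww'; apply: disjoint_between => //.
  by apply: contra (WZ _ w'W) => /(subsetP UZ).
- move=> w wW; have dAA : [disjoint between [set w] (A i) & between [set w] (Ac i)].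
    rewrite -setI_eq0; apply/set0Pn => -[e]; rewrite !inE => /andP [].
    have dAc : [disjoint A i & Ac i].
      apply/bigcup_disjointP => i'; rewrite !inE eq_sym; exact: dA.
    have wA Y : Y \subset U -> w \notin Y.
      by move=> YU; apply: contra (WZ _ wW) => /(subsetP YU) /(subsetP UZ).
    have wAi := wA _ (AU i); have wAci := wA _ (AcU i).
    case/orP => /andP [h1 h2] /orP [] /andP [h3 h4].
    + by rewrite (disjointFr dAc h2) in h4.
    + by rewrite -(eqP h1) h3 in wAci.
    + by rewrite -(eqP h2) h4 in wAci.
    + by rewrite (disjointFr dAc h1) in h3.
  apply: le_trans (prob_hit_miss q01 dAA); rewrite !cb //.
  rewrite cA (card_bigcup_disjoint _ cA dA).
  (* The other groups have at most [K * s] tips in total, so Bernoulli gives at least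
     [1 - q * (K * s) >= 1 / 2]. *)
  have h1 : 2^-1 <= (1 - q) ^+ (#|[set~ i]| * s).
    have : (#|[set~ i]| * s)%:R * q <= (K * s)%:R * q.
      rewrite ler_wpM2r // ler_nat leq_mul2r; apply/orP; right.
      by rewrite -[X in (_ <= X)%N](card_ord K) max_card.
    have hq : -1 <= - q by rewrite lerN2.
    have := bernoulli (#|[set~ i]| * s) hq; lra.
  have h2 : (1 - q) ^+ s <= 1 - s%:R * q / 2.
    by apply: expr_1B_le_half => //; rewrite mulrC; lra.
  have h3 : 0 <= q * s%:R by rewrite mulr_ge0.
  apply: le_trans (_ : 2^-1 * (s%:R * q / 2) <= _); first lra.
  by apply: ler_pM; lra.
- by have : 0 <= q * s%:R; [rewrite mulr_ge0 | move=> ?; apply/andP; split; lra].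
by move: tW; lra.
Qed.

End Exposure.

(** * Joining the tips of two trees, and common neighbours *)

Section Connection.
Variables (R : realType) (m n : nat) (q : R).
Hypothesis q01 : 0 <= q <= 1.
Implicit Types (E : {set 'I_m * 'I_n}) (X Y Z Zx Zy W Wx Wy : {set vtx m n}) (x y v w : vtx m n).

Let q_ge0 : 0 <= q. Proof. by case/andP: q01. Qed.
Let q_le1 : q <= 1. Proof. by case/andP: q01. Qed.

Lemma sub_branches E E' x Z W K j s (A T : 'I_K -> {set vtx m n}) :
  E \subset E' -> branches E x Z W j s A T -> branches E' x Z W j s A T.
Proof.
move=> sE [h1 h2 h3 h4 h5]; split=> // i v /h5 [p [sp pp lp up Tp]].
by exists p; split=> //; apply: sub_path pp => a b; exact: sub_adj.
Qed.

(** If the matching fails, two families [S], [S'] of at least half of the groups span no edge. They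
    offer at least [(K * sx) * (K * sy) / 4] potential edges, still unexposed, and there are
    [4 ^ K <= expR (2 * K)] pairs of families. *)
Lemma prob_not_connected x y Zx Zy Wx Wy K k jx jy sx sy (b : R) side :
  x \in Zx -> y \in Zy -> [disjoint Zx & Zy] ->
  {in Wx, forall w, in_left w = side} -> {in Wy, forall w, in_left w = ~~ side} ->
  (2 * k <= K)%N -> b <= k%:R ->
  prob q (fun E => ~~ `[< many_disjoint_paths E (jx + jy).+1 x y b >]) <=
    (prob q (fun E => ~~ `[< grown (E :&: inside Zx) x Zx Wx K jx sx >]) +
     prob q (fun E => ~~ `[< grown (E :&: inside Zy) y Zy Wy K jy sy >])) +
    expR (2 * K%:R - q * (K * sx)%:R * (K * sy)%:R / 4).
Proof.
move=> xZ yZ dZ sWx sWy kK bk.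
set gx := fun E => `[< grown (E :&: inside Zx) x Zx Wx K jx sx >].
set gy := fun E => `[< grown (E :&: inside Zy) y Zy Wy K jy sy >].
apply: le_trans (_ : prob q (fun E => ~~ (gx E && gy E)) +
  expR (2 * K%:R - q * (K * sx)%:R * (K * sy)%:R / 4) <= _); last first.
  rewrite lerD2r; apply: le_trans (probU q01 _ _); apply: le_prob => // E.
  by rewrite negb_and.
apply: (prob_expose q01 (D := ~: (inside Zx :|: inside Zy))); first exact: expR_ge0.
move=> E' /andP [/asboolP [Ax [Tx bx]] /asboolP [Ay [Ty bY]]].
pose N (SS : {set 'I_K} * {set 'I_K}) :=
  between (\bigcup_(i in SS.1) Ax i) (\bigcup_(i in SS.2) Ay i).
pose big (SS : {set 'I_K} * {set 'I_K}) := (K <= 2 * #|SS.1|)%N && (K <= 2 * #|SS.2|)%N.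
have [AxT cAx TxZ dTx rx] := bx; have [AyT cAy TyZ dTy ry] := bY.
have AxZ (S : {set 'I_K}) : \bigcup_(i in S) Ax i \subset Zx.
  apply/bigcupsP => i _; apply: subset_trans (AxT i) _; apply: subset_trans (subsetIl _ _) _.
  by apply: subset_trans (TxZ i) (subsetDl _ _).
have AyZ (S : {set 'I_K}) : \bigcup_(i in S) Ay i \subset Zy.
  apply/bigcupsP => i _; apply: subset_trans (AyT i) _; apply: subset_trans (subsetIl _ _) _.
  by apply: subset_trans (TyZ i) (subsetDl _ _).
have dAx i i' : i != i' -> [disjoint Ax i & Ax i'].
  move=> ii'; apply: disjointWl (subset_trans (AxT i) (subsetIl _ _)) _.
  by apply: disjointWr (subset_trans (AxT i') (subsetIl _ _)) (dTx _ _ ii').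
have dAy i i' : i != i' -> [disjoint Ay i & Ay i'].
  move=> ii'; apply: disjointWl (subset_trans (AyT i) (subsetIl _ _)) _.
  by apply: disjointWr (subset_trans (AyT i') (subsetIl _ _)) (dTy _ _ ii').
(* Since the zones are disjoint, an edge between the two sets of tips lies inside neither zone, so
   it has not been exposed. *)
have ND SS : N SS \subset ~: (inside Zx :|: inside Zy).
  apply/subsetP => e; rewrite !inE.
  case/orP => /andP [h1 h2].
    have {}h1 := subsetP (AxZ _) _ h1; have {}h2 := subsetP (AyZ _) _ h2.
    by rewrite (disjointFr dZ h1) (disjointFl dZ h2) andbF.
  have {}h1 := subsetP (AyZ _) _ h1; have {}h2 := subsetP (AxZ _) _ h2.
  by rewrite (disjointFr dZ h2) (disjointFl dZ h1) andbF.
apply: le_trans (_ : prob q (fun E => [exists (SS | big SS), [disjoint E & N SS]]) <= _).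
  apply: le_prob => // E; apply: contraNT => /existsPn hE; apply/asboolP.
  have sE : E' :&: inside Zx \subset E :&: ~: (inside Zx :|: inside Zy)
      :|: E' :\: ~: (inside Zx :|: inside Zy).
    by apply/subsetP => e; rewrite !inE negbK => /andP [-> ->]; rewrite orbT.
  have sE2 : E' :&: inside Zy \subset E :&: ~: (inside Zx :|: inside Zy)
      :|: E' :\: ~: (inside Zx :|: inside Zy).
    by apply/subsetP => e; rewrite !inE negbK => /andP [-> ->]; rewrite !orbT.
  apply: (many_disjoint_paths_of_branches xZ yZ dZ kK bk (sub_branches sE bx) (sub_branches sE2 bY)).
  move=> S S' hS hS'; have := hE (S, S'); rewrite /big /= hS hS' /=; apply: contra => dE.
  rewrite -setI_eq0 -(setIidPl (ND (S, S'))) setIA setIAC setI_eq0.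
  by apply: disjointWl dE; apply/subsetP => e; rewrite !inE => /andP [-> ->].
apply: le_trans (prob_exists q01 _ _) _.
have two_le := exp2_le_expR R K.
have -> : 2 * K%:R - q * (K * sx)%:R * (K * sy)%:R / 4
  = K%:R + K%:R - q * (K * sx)%:R * (K * sy)%:R / 4 by ring.
rewrite !expRD.
apply: le_trans (_ : \sum_(SS : {set 'I_K} * {set 'I_K})
   expR (- (q * (K * sx)%:R * (K * sy)%:R / 4)) <= _); last first.
  have cardK : #|{set 'I_K}| = (2 ^ K)%N.
    by rewrite -cardsT -powersetT card_powerset cardsT card_ord.
  rewrite sumr_const card_prod cardK -[leLHS]mulr_natl natrM natrX.
  rewrite ler_wpM2r ?expR_ge0 //; apply: ler_pM => //; exact: exprn_ge0.
rewrite [leRHS](bigID big) /= -[leLHS]addr0 lerD //; last first.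
  by apply: sumr_ge0 => ? _; exact: expR_ge0.
apply: ler_sum => -[S S'] /andP [/= hS hS']; rewrite prob_disjoint //.
apply: le_trans (expr_1Bx_le _ _) _ => //; rewrite ler_expR lerN2.
rewrite (card_between (s := side)); first last.
- by move=> w /bigcupP [i _ /(subsetP (AyT i))]; rewrite inE => /andP [_ /sWy].
- by move=> w /bigcupP [i _ /(subsetP (AxT i))]; rewrite inE => /andP [_ /sWx].
rewrite !(card_bigcup_disjoint _ cAx dAx) !(card_bigcup_disjoint _ cAy dAy).
rewrite [leRHS]mulrC -!mulrA ler_wpM2l // !mulrA ler_pdivrMr // -!natrM ler_nat.
have -> : (#|S| * sx * (#|S'| * sy) * 4 = (2 * #|S| * sx) * (2 * #|S'| * sy))%N by ring.
by apply: leq_mul; rewrite leq_mul2r ?hS ?hS' orbT.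
Qed.

(** A vertex of [W] is a common neighbour with probability [q ^+ 2], independently of the others,
    and each common neighbour is the interior of one path. *)
Lemma prob_not_codegree x y W (b : R) k :
  x != y -> {in W, forall w, in_left w = ~~ in_left x} -> in_left x = in_left y ->
  b <= k%:R -> k%:R <= q ^+ 2 * #|W|%:R / 4 ->
  prob q (fun E => ~~ `[< many_disjoint_paths E 2 x y b >])
    <= expR (- (q ^+ 2 * #|W|%:R / 4)).
Proof.
move=> xy sW sxy bk kW; pose B w := between [set w] [set x; y].
pose ev w E := B w \subset E.
have nWx w : w \in W -> w != x.
  by move=> wW; apply/eqP => e; have := sW w wW; rewrite e; case: (in_left x).
have nWy w : w \in W -> w != y.
  by move=> wW; apply/eqP => e; have := sW w wW; rewrite e sxy; case: (in_left y).
apply: le_trans (_ : prob q (fun E => (#|[set w in W | ev w E]| <= k)%N) <= _).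
  apply: le_prob => // E; apply: contraNT; rewrite -ltnNge => kE; apply/asboolP.
  pose l := enum [set w in W | ev w E].
  have lW w : w \in l -> w \in W by rewrite mem_enum inE => /andP [].
  have lE w : w \in l -> adj E w x /\ adj E w y.
    move=> wl; have := sW _ (lW _ wl); move: wl.
    rewrite mem_enum inE => /andP [_ /subsetP]; move: sxy; rewrite /B; clear.
    case: w x y => [w|w] [x|x] [y|y] //= _ wE _; split; apply: wE;
    by rewrite !inE /= !eqxx ?orbT.
  exists [seq [:: w; y] | w <- l]; split.
  - by rewrite size_map -cardE; apply: le_trans bk _; rewrite ler_nat ltnW.
  - rewrite all_map; apply/allP => w wl /=; have [ax ay] := lE _ wl.
    rewrite /is_path_len /= adjC ax ay eqxx !inE (eq_sym x w) (negbTE (nWx _ (lW _ wl))).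
    by rewrite (negbTE xy) nWy // lW.
  rewrite pairwise_map; have := enum_uniq [set w in W | ev w E]; rewrite uniq_pairwise.
  apply: (sub_in_pairwise (P := mem W)); last by apply/allP => w; exact: lW.
  move=> w w' /nWy wy /nWy wy' ww'; rewrite /interior /= eqxx wy wy' /= orbF inE.
  exact: ww'.
apply: (chernoff_lower q01 (B := B)) => //.
- by move=> w _ E; rewrite /ev subsetI subxx andbT.
- move=> w w' _ w'W ww'; apply: disjoint_between => //.
  by rewrite !inE negb_or nWx ?nWy.
- move=> w wW; rewrite prob_subset // (card_between (s := in_left w)).
  + by rewrite cards1 cards2 xy mul1n.
  + by move=> v /set1P ->.
  by move=> v /set2P [->|->]; rewrite (sW w) // ?sxy negbK.
by rewrite exprn_ge0 // exprn_ile1.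
Qed.

End Connection.

(** * Growth rates *)

Section Levels.
Variables (R : realType) (m n : nat).
Implicit Types (E : {set 'I_m * 'I_n}) (x y v w : vtx m n) (s : bool) (M c j : nat).

Definition part_size m n s : nat := if s then m else n.

Definition index v : nat := match v with inl i => i | inr i => i end.

(** Residue classes of the index give disjoint levels fixed before any edge is exposed; both roots
    are removed so that neither tree can meet the other root. *)
Definition level x y M c s : {set vtx m n} :=
  [set v | [&& in_left v == s, index v %% M == c, v != x & v != y]]%N.

(** The indices [k * M + c] with [k < N %/ M] all lie in the class, and at most the two roots are
    lost. *)
Lemma card_level x y M c s : (c < M)%N ->
  (part_size m n s %/ M <= #|level x y M c s| + 2)%N.
Proof.
move=> cM; set N := part_size m n s; set r := (N %/ M)%N.
have Npos (k : 'I_r) : (k * M + c < N)%N.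
  apply: leq_trans (_ : k.+1 * M <= _)%N; first by rewrite mulSn addnC ltn_add2r.
  by apply: leq_trans (leq_divM N M); rewrite leq_mul2r ltn_ord orbT.
pose L := [set v : vtx m n | (in_left v == s) && (index v %% M == c)%N].
have LL : L \subset level x y M c s :|: [set x; y].
  apply/subsetP => v; rewrite !inE => /andP [-> ->] /=.
  by case: (v == x); case: (v == y).
apply: leq_trans (_ : #|L| <= _)%N; last first.
  apply: leq_trans (subset_leq_card LL) _; apply: leq_trans (leq_card_setU _ _) _.
  by rewrite leq_add2l cards2; case: eqP.
have [f finj fL] : exists2 f : 'I_r -> vtx m n, injective f & forall k, f k \in L.
  have mod_c k : ((k * M + c) %% M = c)%N by rewrite modnMDl modn_small.
  have inj k k' : (k * M + c = k' * M + c)%N -> k = k'.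
    by move=> /eqP; rewrite eqn_add2r eqn_mul2r; case: (M) cM => //= ? _ /eqP.
  move: Npos; rewrite /r /N /L /part_size; case: (s) => Npos.
    exists (fun k => inl (Ordinal (Npos k))); last by move=> k; rewrite inE /= mod_c eqxx.
    by move=> k k' [] /inj /val_inj.
  exists (fun k => inr (Ordinal (Npos k))); last by move=> k; rewrite inE /= mod_c eqxx.
  by move=> k k' [] /inj /val_inj.
rewrite -(card_ord r) -cardsT -(card_imset _ finj); apply: subset_leq_card.
by apply/subsetP => _ /imsetP [k _ ->].
Qed.

(** Rounding and the two roots cost at most three multiples of [M], which is at most half of the
    part. *)
Lemma card_level_ge x y M c s : (c < M)%N -> (6 * M <= part_size m n s)%N ->
  (part_size m n s)%:R / (2 * M%:R) <= #|level x y M c s|%:R :> R.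
Proof.
move=> cM; have := card_level x y s cM; set N := part_size m n s; set L := #|_|.
move=> NL MN; have M0 : (0 < M)%N by apply: leq_ltn_trans cM.
have M0' : 0 < M%:R :> R by rewrite ltr0n.
rewrite ler_pdivrMr; last lra.
have : (N <= (L + 3) * M)%N.
  rewrite {1}(divn_eq N M); have := ltn_pmod N M0; nia.
rewrite -(ler_nat R) natrM natrD => NLM.
move: MN; rewrite -(ler_nat R) natrM; nra.
Qed.

(* [x] and its first [j] levels, which use the residue classes [c], ..., [c + j - 1]. *)
Fixpoint zone x y M c j : {set vtx m n} :=
  if j is j'.+1 then zone x y M c j' :|: level x y M (c + j') (in_left x (+) odd j)
  else [set x].

Lemma zoneP x y M c j v : v \in zone x y M c j ->
  v = x \/ [/\ v != x, v != y & (c <= index v %% M < c + j)%N].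
Proof.
elim: j => [|j IH] /=; first by move=> /set1P; left.
rewrite !inE => /orP [/IH [|[-> -> /andP [h1 h2]]]|/and4P [_ /eqP -> -> ->]]; first by left.
  by right; split=> //; rewrite h1 addnS ltnS ltnW.
by right; split=> //; rewrite leq_addr addnS ltnSn.
Qed.

Lemma zone_root x y M c j : x \in zone x y M c j.
Proof. by elim: j => [|j IH] /=; rewrite ?inE ?eqxx // IH. Qed.

Lemma disjoint_level_zone x y M c j s :
  [disjoint level x y M (c + j) s & zone x y M c j].
Proof.
rewrite -setI_eq0; apply/set0Pn => -[v]; rewrite !inE => /andP [/and4P [_ /eqP e vx vy]].
by move=> /zoneP [vx'|[_ _]]; [rewrite vx' eqxx in vx | rewrite e ltnn andbF].
Qed.

(** The tree of [x] uses the residues below [a], that of [y] the next [b] ones. *)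
Lemma disjoint_zones x y M a b : x != y -> [disjoint zone x y M 0 a & zone y x M a b].
Proof.
move=> xy; rewrite -setI_eq0; apply/set0Pn => -[v]; rewrite inE.
case/andP => /zoneP [->|[vx vy /andP [_ h]]] /zoneP [e|[vy' vx' /andP [h' _]]].
- by rewrite e eqxx in xy.
- by rewrite eqxx in vx'.
- by rewrite e eqxx in vy.
by rewrite leqNgt h in h'.
Qed.

(* Nominal size of the [j]-th neighbourhood of a vertex of side [s]. *)
Definition growth m n (q : R) s j : R :=
  \prod_(i < j) (q * (part_size m n (s (+) odd i.+1))%:R).

Section Growth.
Variable q : R.
Hypothesis q_ge0 : 0 <= q.

Lemma growthS s j :
  growth m n q s j.+1 = growth m n q s j * (q * (part_size m n (s (+) odd j.+1))%:R).
Proof. by rewrite /growth big_ord_recr. Qed.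

Lemma growth_ge0 s j : 0 <= growth m n q s j.
Proof. by apply: prodr_ge0 => i _; rewrite mulr_ge0. Qed.

Lemma growth0 s : growth m n q s 0 = 1.
Proof. by rewrite /growth big_ord0. Qed.

Lemma growthSl s j :
  growth m n q s j.+1 = q * (part_size m n (~~ s))%:R * growth m n q (~~ s) j.
Proof.
rewrite /growth big_ord_recl /= addbT; congr (_ * _).
by apply: eq_bigr => i _; rewrite /bump /= !negbK addbN addNb negbK.
Qed.

(** At every depth one of the two products gains a factor [q * m] and the other [q * n]. *)
Lemma growth_dual s j :
  growth m n q s j * growth m n q (~~ s) j = (q ^+ 2 * (m%:R * n%:R)) ^+ j.
Proof.
rewrite /growth -big_split /= -[j in RHS]card_ord -prodr_const.
by apply: eq_bigr => i _; rewrite /part_size; case: (s); case: (odd i) => /=; ring.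
Qed.

Lemma le_growth s i j : (forall s, 1 <= q * (part_size m n s)%:R) -> (i <= j)%N ->
  growth m n q s i <= growth m n q s j.
Proof.
move=> h /subnKC <-; elim: (j - i)%N => [|k IH]; first by rewrite addn0.
by rewrite addnS growthS; apply: le_trans IH _; rewrite ler_peMr ?growth_ge0.
Qed.

Lemma growth_ge s j gam : 1 <= gam -> (forall s, gam <= q * (part_size m n s)%:R) ->
  (0 < j)%N -> gam <= growth m n q s j.
Proof.
move=> gam1 h j0; apply: le_trans (_ : growth m n q s 1 <= _).
  by rewrite growthS growth0 mul1r.
by apply: le_growth => // s'; apply: le_trans gam1 _.
Qed.

End Growth.

Section Rate.
Variable q : R.
Hypothesis q01 : 0 <= q <= 1.
Let q_ge0 : 0 <= q. Proof. by case/andP: q01. Qed.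

Variables (M K : nat) (gam : R).
Hypotheses (K_gt0 : (0 < K)%N) (gamK : 32 * K%:R <= gam).
Hypothesis gam_le : forall s, gam <= q * (part_size m n s)%:R / (2 * M%:R).
Hypothesis part_ge : forall s, (6 * M <= part_size m n s)%N.

(* A factor [2 M] is lost to the residue classes and to excluding [x] and [y], a
   factor 16 in the Chernoff bound, a factor 2 in rounding; hence [64 M] per level. *)
Lemma grown_rate x y c j : (c + j < M)%N ->
  (forall i, (0 < i <= j)%N -> q * growth m n q (in_left x) i <= 2^-1) ->
  exists s : nat, [/\ (0 < s)%N,
    growth m n q (in_left x) j.+1 / (64 * M%:R) ^+ j.+1 <= (K * s)%:R,
    (K * s)%:R <= growth m n q (in_left x) j.+1 &
    prob q (fun E => ~~ `[< grown (E :&: inside (zone x y M c j.+1)) x (zone x y M c j.+1)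
        (level x y M (c + j) (in_left x (+) odd j.+1)) K j.+1 s >])
      <= j.+1%:R * (K%:R * expR (- (gam / 16)))].
Proof.
have hK := gamK; have K1 : 1 <= K%:R :> R by rewrite ler1n.
elim: j => [|j IH] cM hq.
  set W := level _ _ _ _ _; set N := part_size m n (in_left x (+) true).
  have M0 : 0 < M%:R :> R by rewrite ltr0n; apply: leq_ltn_trans cM.
  have hW : N%:R / (2 * M%:R) <= #|W|%:R :> R by exact: card_level_ge.
  set z := q * N%:R / (2 * M%:R).
  have hz : gam <= z by exact: gam_le.
  have hzW : z <= q * #|W|%:R by rewrite /z -mulrA ler_wpM2l.
  have zN : q * N%:R = z * (2 * M%:R) by rewrite /z divfK // mulf_neq0 // gt_eqF.
  have M1 : 1 <= M%:R :> R by rewrite ler1n -(ltr0n R).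
  clearbody z; have z0 : 0 <= z by lra.
  (* The divisor keeps [K * s] below [z / 4], the threshold of [prob_not_grown_start]; as the
     quotient is at least 8, rounding leaves [K * s] above [z / 16]. *)
  set s := Num.truncn (z / (4 * K%:R)).
  have K4 : 0 < 4 * K%:R :> R by lra.
  have sle : s%:R * (4 * K%:R) <= z.
    by rewrite -ler_pdivlMr // truncn_le divr_ge0; lra.
  have sgt : z < (s%:R + 1) * (4 * K%:R).
    by rewrite -ltr_pdivrMr // natr1 truncnS_gt.
  exists s; split.
  - by rewrite /s truncn_gt0 ler_pdivlMr //; lra.
  - rewrite /growth big_ord1 expr1 -/N zN ler_pdivrMr; last lra.
    rewrite natrM; have : z * 1 <= z * M%:R by rewrite ler_wpM2l.
    have : z / 16 <= K%:R * s%:R by lra.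
    by move=> h _; apply: le_trans (_ : z / 16 * (64 * M%:R) <= _); [nra | rewrite ler_wpM2r //; lra].
  - rewrite /growth big_ord1 -/N zN natrM; nra.
  rewrite mul1r; apply: le_trans (prob_not_grown_start q01 _ _) _.
  - by move=> w; rewrite inE => /andP [/eqP -> _]; rewrite addbT.
  - by rewrite natrM; lra.
  apply: le_trans (_ : 1 * expR (- (gam / 16)) <= _); last by rewrite ler_wpM2r ?expR_ge0.
  by rewrite mul1r ler_expR; lra.
have [||s [s0 slo shi IHp]] := IH; [by lia | by move=> i hi; apply: hq; lia |].
set W := level x y M (c + j.+1) (in_left x (+) odd j.+2).
set N := part_size m n (in_left x (+) odd j.+2).
have M0 : 0 < M%:R :> R by rewrite ltr0n; apply: leq_ltn_trans cM.
have hW : N%:R / (2 * M%:R) <= #|W|%:R :> R by exact: card_level_ge.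
set z := q * N%:R / (2 * M%:R).
have hz : gam <= z by exact: gam_le.
have hzW : z <= q * #|W|%:R by rewrite /z -mulrA ler_wpM2l.
have zN : q * N%:R = z * (2 * M%:R) by rewrite /z divfK // mulf_neq0 // gt_eqF.
have M1 : 1 <= M%:R :> R by rewrite ler1n -(ltr0n R).
have s1 : 1 <= s%:R :> R by rewrite ler1n.
clearbody z.
have z32 : 32 <= z by lra.
have sz : z <= s%:R * z by rewrite ler_peMl //; lra.
(* Since [s * z >= 32], rounding costs at most a factor 2, so [t >= s * z / 32]. *)
set t := Num.truncn (s%:R * z / 16).
have tle : t%:R <= s%:R * z / 16 by rewrite truncn_le; lra.
have tgt : s%:R * z / 16 < t%:R + 1 by rewrite natr1 truncnS_gt.
have zs0 : 0 <= s%:R * z by lra.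
exists t; split.
- by rewrite /t truncn_gt0; lra.
- rewrite growthS -/N zN exprSr invfM mulrACA.
  apply: le_trans (_ : (K * s)%:R * (z * (2 * M%:R) / (64 * M%:R)) <= _).
    rewrite ler_wpM2r //; rewrite divr_ge0 //; try lra.
    by rewrite mulr_ge0; lra.
  have -> : z * (2 * M%:R) / (64 * M%:R) = z / 32 by field; rewrite gt_eqF.
  rewrite !natrM -mulrA ler_wpM2l //; lra.
- rewrite growthS -/N zN.
  apply: le_trans (_ : (K * s)%:R * (z * (2 * M%:R)) <= _); last first.
    by rewrite ler_wpM2r // mulr_ge0; lra.
  rewrite !natrM -mulrA ler_wpM2l //.
  apply: le_trans (_ : s%:R * z * 1 <= _); first lra.
  by rewrite mulrA ler_wpM2l //; lra.
apply: le_trans (@prob_not_grown_step _ _ _ _ q01 x (zone x y M c j.+1) W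
  (level x y M (c + j) (in_left x (+) odd j.+1)) K j.+1 s t (in_left x (+) odd j.+1) _ _ _ _ _ _) _.
- exact: zone_root.
- exact: disjoint_level_zone.
- by move=> w; rewrite inE => /andP [/eqP].
- by move=> w; rewrite inE => /andP [/eqP -> _]; rewrite /= addbN.
(* The total size of the tips is at most the nominal growth, so the hypothesis at depth [j.+1]
   controls [q * (K * s)]. *)
- apply: le_trans (hq j.+1 _); last by rewrite ltnSn.
  by rewrite ler_wpM2l.
- apply: le_trans tle _; rewrite ler_pM2r ?invr_gt0 //.
  by rewrite (mulrC q) -mulrA ler_wpM2l.
rewrite -[j.+2%:R]natr1 mulrDl mul1r; apply: lerD; first exact: IHp.
rewrite ler_wpM2l // ler_expR lerN2 ler_pM2r ?invr_gt0 //.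
by apply: le_trans hz _; apply: le_trans sz _; rewrite (mulrC q) -mulrA ler_wpM2l.
Qed.

End Rate.
End Levels.

(** * Failure probability for one pair of vertices *)

Section Pair.
Variables (R : realType) (m n : nat) (q : R).
Hypothesis q01 : 0 <= q <= 1.
Implicit Types (E : {set 'I_m * 'I_n}) (x y v w : vtx m n) (s : bool).

Let q_ge0 : 0 <= q. Proof. by case/andP: q01. Qed.

(** Trees of depths [a] and [b] are grown in [a + b] residue classes; the parity condition puts
    their last levels on opposite sides, and the joining edge makes the length [(a + b).+1]. *)
Lemma prob_not_connected_pair x y a b K k gam (c : R) : x != y ->
  (0 < a)%N -> (0 < b)%N ->
  in_left x (+) odd a = ~~ (in_left y (+) odd b) ->
  (0 < K)%N -> 32 * K%:R <= gam ->
  (forall s, gam <= q * (part_size m n s)%:R / (2 * (a + b)%:R)) ->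
  (forall s, (6 * (a + b) <= part_size m n s)%N) ->
  (2 * k <= K)%N -> c <= k%:R ->
  q * growth m n q (in_left x) a.-1 <= 2^-1 ->
  q * growth m n q (in_left y) b.-1 <= 2^-1 ->
  prob q (fun E => ~~ `[< many_disjoint_paths E (a + b).+1 x y c >]) <=
    (a + b)%:R * (K%:R * expR (- (gam / 16))) +
    expR (2 * K%:R - q * growth m n q (in_left x) a * growth m n q (in_left y) b
      / (64 * (a + b)%:R) ^+ (a + b) / 4).
Proof.
case: a => // a; case: b => // b xy _ _ opp K0 gamK gam_le part6 kK ck hx hy.
have K1 : 1 <= K%:R :> R by rewrite ler1n.
(* Every factor of [growth] is at least 1, so [growth] is monotone and smallness at the deepest
   expanded level covers the earlier ones. *)
have p1 s : 1 <= q * (part_size m n s)%:R.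
  have M1 : 1 <= (2 * (a.+1 + b.+1)%:R : R) by rewrite -natrM ler1n.
  have := gam_le s; rewrite ler_pdivlMr; last lra.
  have : gam * 1 <= gam * (2 * (a.+1 + b.+1)%:R) by rewrite ler_wpM2l //; lra.
  lra.
have [|i hi|sx [_ sxlo _ Px]] := grown_rate q01 K0 gamK gam_le part6 y (x := x) (c := 0) (j := a).
- by rewrite add0n addSn ltnS leq_addr.
- by apply: le_trans hx; rewrite ler_wpM2l // (le_growth q_ge0) //; case/andP: hi.
have [|i hi|sy [_ sylo _ Py]] := grown_rate q01 K0 gamK gam_le part6 x (x := y) (c := a.+1) (j := b).
- by rewrite addnS.
- by apply: le_trans hy; rewrite ler_wpM2l // (le_growth q_ge0) //; case/andP: hi.
set Wx := level _ _ _ _ _ in Px; set Wy := level _ _ _ _ _ in Py.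
have sWx : {in Wx, forall w, in_left w = in_left x (+) odd a.+1}.
  by move=> w; rewrite inE => /andP [/eqP].
have sWy : {in Wy, forall w, in_left w = ~~ (in_left x (+) odd a.+1)}.
  by move=> w; rewrite inE opp negbK => /andP [/eqP].
apply: le_trans (@prob_not_connected _ _ _ _ q01 x y _ _ Wx Wy K k a.+1 b.+1 sx sy c _
  (zone_root _ _ _ _ _) (zone_root _ _ _ _ _) (@disjoint_zones m n x y (a.+1 + b.+1) a.+1 b.+1 xy) sWx sWy kK ck) _.
apply: lerD; first by rewrite natrD mulrDl; exact: lerD Px Py.
rewrite ler_expR lerD2l lerN2 ler_pM2r ?invr_gt0 // exprD.
have M0 : 0 <= (64 * (a.+1 + b.+1)%:R : R) by rewrite mulr_ge0.
have -> (u v w z : R) : q * u * v / (w * z) = q * (u / w * (v / z)).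
  by rewrite invfM -!mulrA; do 2!congr (_ * _); rewrite mulrCA.
by rewrite -[leRHS]mulrA ler_wpM2l // ler_pM // divr_ge0 ?(growth_ge0 _ _ q_ge0) ?exprn_ge0.
Qed.

End Pair.

(** This is where the exponent [10 * d] is spent: the powers of 2 are compared after
    [d <= 2 ^ d.-1], and [d = 2] gives equality. *)
Lemma exp2_dominates d : (2 <= d)%N -> (64 * (64 * d) ^ d <= 2 ^ (10 * d * d.-1))%N.
Proof.
case: d => // d d1; rewrite expnMn mulnA -expnS -[64%N]/(2 ^ 6)%N -expnM /=.
have dd : (d.+1 ^ d.+1 <= 2 ^ (d * d.+1))%N by rewrite expnM leq_exp2r // ltn_expl.
apply: leq_trans (leq_mul (leqnn _) dd) _; rewrite -expnD leq_exp2l //; nia.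
Qed.

(** * Absorbing the constants into a failure bound [expR (- (5 * L))] *)

Section Numeric.
Variables (R : realType) (m n d : nat) (q B C L : R).
Hypotheses (q01 : 0 <= q <= 1) (d_ge2 : (2 <= d)%N).
Hypotheses (B_ge : 2 ^+ (10 * d) <= B) (BC : B <= C).
Hypothesis L_ge : 256 * d%:R * (d%:R + B + 6) <= L.
Hypothesis qL : forall s, L ^+ 4 <= q * (part_size m n s)%:R.
Implicit Types (E : {set 'I_m * 'I_n}) (x y v w : vtx m n) (s : bool).

(** Growth and connection each fail with probability at most [expR (- (6 * L))]: [L ^+ 4] dominates
    the number of groups and levels, and the choice of groups costs [4 * k <= 8 * B * L] against at
    least [16 * C * L]. *)
Lemma prob_not_connected_le x y a b : x != y ->
  (0 < a)%N -> (0 < b)%N -> (a + b <= d)%N ->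
  in_left x (+) odd a = ~~ (in_left y (+) odd b) ->
  q * growth m n q (in_left x) a.-1 <= 2^-1 ->
  q * growth m n q (in_left y) b.-1 <= 2^-1 ->
  C ^+ d * L <= q * growth m n q (in_left x) a * growth m n q (in_left y) b ->
  prob q (fun E => ~~ `[< many_disjoint_paths E (a + b).+1 x y (B * L) >])
    <= expR (- (5 * L)).
Proof.
move=> xy a0 b0 abd opp hx hy hC.
have [q0 q1] := andP q01; have hL := L_ge; have hBC := BC.
have d0 : (0 < d)%N by exact: ltnW.
have d2 : 2 <= d%:R :> R by rewrite ler_nat.
have B1 : 1 <= B by apply: le_trans B_ge; rewrite exprn_ege1 // ler1n.
have T1 : 1 <= 256 * d%:R * (d%:R + B + 6) by rewrite mulr_ege1 //; lra.
have L1 : 1 <= L by exact: le_trans hL.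
have L4 : 256 * d%:R * (d%:R + B + 6) * L <= L ^+ 4.
  apply: le_trans (_ : L * L <= _); first by rewrite ler_wpM2r //; lra.
  by rewrite -expr2 ler_weXn2l.
have BL1 : 1 <= B * L by rewrite mulr_ege1.
have BL_L : L <= B * L by rewrite ler_peMl //; lra.
have dL_d : d%:R <= d%:R * L by rewrite ler_peMr.
have dL0 : 0 <= d%:R * L by lra.
have ddL0 : 0 <= d%:R * d%:R * L by rewrite -mulrA mulr_ge0.
have dBL0 : 0 <= d%:R * B * L by rewrite -mulrA mulr_ge0 //; lra.
set k := (Num.truncn (B * L)).+1.
have BL0 : 0 <= B * L by lra.
have kge : B * L <= k%:R by apply: ltW; rewrite truncnS_gt.
have kle : k%:R <= 2 * (B * L).
  have : (Num.truncn (B * L))%:R <= B * L by rewrite truncn_le.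
  by rewrite /k -natr1; lra.
set M := (a + b)%N in abd *.
have M2 : 2 <= M%:R :> R by rewrite ler_nat (leq_add a0 b0).
have Md : M%:R <= d%:R :> R by rewrite ler_nat.
(* The [2 * d] bounds the factor [2 * M] lost to the residue classes, as [M <= d]. *)
pose gam := L ^+ 4 / (2 * d%:R).
have egam : L ^+ 4 = gam * (2 * d%:R) by rewrite /gam divfK // mulf_neq0 // pnatr_eq0 -lt0n.
have K2 : (2 * k)%:R = 2 * k%:R :> R by rewrite natrM.
have gam_ge : 128 * (d%:R + B + 6) * L <= gam.
  rewrite /gam ler_pdivlMr; last lra.
  by apply: le_trans L4; rewrite le_eqVlt; apply/orP; left; apply/eqP; ring.
apply: le_trans (@prob_not_connected_pair _ _ _ _ q01 x y a b (2 * k) k gam _ xy a0 b0 opp _ _ _ _ _ kge hx hy) _.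
- by rewrite muln_gt0.
- rewrite K2; lra.
- move=> s; rewrite /gam; apply: ler_pM => //.
  + by rewrite exprn_ge0 //; lra.
  + by rewrite invr_ge0; lra.
  by rewrite -/M lef_pV2 ?posrE; lra.
- move=> s; rewrite -(ler_nat R) natrM -/M; apply: le_trans (_ : L ^+ 4 <= _); first lra.
  by apply: le_trans (qL s) _; rewrite -[leRHS]mul1r ler_wpM2r.
- exact: leqnn.
have eL : 2 * expR (- (6 * L)) <= expR (- (5 * L)).
  have -> : - (5 * L) = L + - (6 * L) by ring.
  rewrite expRD ler_wpM2r ?expR_ge0 //; have := expR_ge1Dx L; lra.
apply: le_trans (_ : expR (- (6 * L)) + expR (- (6 * L)) <= _); last lra.
rewrite -/M K2; apply: lerD.
  have eM : M%:R <= expR M%:R :> R by have := expR_ge1Dx (M%:R : R); lra.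
  have eK : 2 * k%:R <= expR (2 * k%:R) :> R by have := expR_ge1Dx (2 * k%:R : R); lra.
  apply: le_trans (_ : expR M%:R * (expR (2 * k%:R) * expR (- (gam / 16))) <= _).
    by apply: ler_pM => //; rewrite ?mulr_ge0 ?expR_ge0 // ler_wpM2r ?expR_ge0.
  rewrite -!expRD ler_expR; lra.
rewrite ler_expR.
have C0 : 0 <= C by lra.
(* Of the factor [C ^+ d], the part [C ^+ d.-1] pays for the level losses [(64 * d) ^+ d] and for
   the 64, by [exp2_dominates]. *)
have hF : 64 * C * L <= q * growth m n q (in_left x) a * growth m n q (in_left y) b
      / (64 * M%:R) ^+ M.
  have M64 : 0 < (64 * M%:R) ^+ M :> R by rewrite exprn_gt0 //; lra.
  rewrite ler_pdivlMr //; apply: le_trans hC.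
  apply: le_trans (_ : 64 * C * L * (64 * d%:R) ^+ d <= _).
    rewrite ler_wpM2l //; first by rewrite !mulr_ge0 //; lra.
    apply: le_trans (_ : (64 * M%:R) ^+ d <= _).
      by rewrite ler_weXn2l //; lra.
    by rewrite lerXn2r ?nnegrE //; lra.
  have -> : C ^+ d = C ^+ d.-1 * C by rewrite -exprSr prednK.
  have hd : 64 * (64 * d%:R) ^+ d <= C ^+ d.-1.
    apply: le_trans (_ : (2 ^+ (10 * d)) ^+ d.-1 <= _).
      have := exp2_dominates d_ge2; rewrite -(ler_nat R) !(natrM, natrX) => h.
      by rewrite -exprM.
    by rewrite lerXn2r ?nnegrE ?exprn_ge0 //; have := B_ge; lra.
  have CL0 : 0 <= C * L by rewrite mulr_ge0; lra.
  have := ler_wpM2r CL0 hd; lra.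
have CL_BL : B * L <= C * L by rewrite ler_wpM2r //; lra.
lra.
Qed.

(** [C ^+ 2 >= 1024 * B] leaves room both for the threshold [k <= 2 * B * L] and for the
    exponent. *)
Lemma prob_not_codegree_le x y : x != y -> in_left x = in_left y -> d = 2 ->
  C ^+ 2 * L <= q ^+ 2 * (part_size m n (~~ in_left x))%:R ->
  prob q (fun E => ~~ `[< many_disjoint_paths E 2 x y (B * L) >])
    <= expR (- (5 * L)).
Proof.
move=> xy sxy ed hC.
have [q0 q1] := andP q01; have hL := L_ge; have hBC := BC.
have d2 : 2 <= d%:R :> R by rewrite ler_nat.
have B1 : 1024 <= B.
  by apply: le_trans B_ge; rewrite ed /= !exprS expr0; lra.
have T1 : 256 <= 256 * d%:R * (d%:R + B + 6).
  by rewrite -[leLHS]mulr1 ler_pM //; lra.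
have L1 : 256 <= L by exact: le_trans hL.
have BL1 : 1 <= B * L by rewrite mulr_ege1 //; lra.
have BL_L : 1024 * L <= B * L by rewrite ler_wpM2r //; lra.
set k := (Num.truncn (B * L)).+1.
have BL0 : 0 <= B * L by lra.
have kge : B * L <= k%:R by apply: ltW; rewrite truncnS_gt.
have kle : k%:R <= 2 * (B * L).
  have : (Num.truncn (B * L))%:R <= B * L by rewrite truncn_le.
  by rewrite /k -natr1; lra.
set s := ~~ in_left x in hC *.
have p6 : (6 * 1 <= part_size m n s)%N.
  rewrite muln1 -(ler_nat R); apply: le_trans (_ : L ^+ 4 <= _).
    have : L * 1 <= L * L ^+ 3 by rewrite ler_wpM2l ?exprn_ege1 //; lra.
    rewrite -exprS; lra.
  by apply: le_trans (qL s) _; rewrite -[leRHS]mul1r ler_wpM2r.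
(* Modulus 1 has a single class, so the level is the whole opposite part. *)
have hW := card_level_ge R x y (ltn0Sn 0) p6.
set W := level x y 1 0 s in hW.
have qW : C ^+ 2 * L / 2 <= q ^+ 2 * #|W|%:R.
  apply: le_trans (_ : q ^+ 2 * ((part_size m n s)%:R / (2 * 1)) <= _); first lra.
  by rewrite ler_wpM2l // exprn_ge0.
have C2 : 1024 * (B * L) <= C ^+ 2 * L.
  by rewrite mulrA ler_wpM2r //; [lra | rewrite expr2 ler_pM //; lra].
apply: le_trans (prob_not_codegree q01 (W := W) xy _ sxy kge _) _.
- by move=> w; rewrite inE => /andP [/eqP].
- lra.
rewrite ler_expR; lra.
Qed.

End Numeric.

(** * Choosing the depths of the two trees according to the parity of [d] *)

Section Pairs.
Variables (R : realType) (m n d : nat) (q B C L : R).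
Hypotheses (q_ge0 : 0 <= q) (d_ge2 : (2 <= d)%N).
Hypotheses (B_ge : 2 ^+ (10 * d) <= B) (BC : B <= C).
Hypothesis L_ge : 256 * d%:R * (d%:R + B + 6) <= L.
Hypothesis CL : 4 * C ^+ d <= L.
Hypothesis qL : forall s, L ^+ 4 <= q * (part_size m n s)%:R.

Let B_ge1 : 1 <= B.
Proof. by apply: le_trans B_ge; rewrite exprn_ege1 // ler1n. Qed.

Let L_ge1 : 1 <= L.
Proof.
have hL := L_ge; have hB := B_ge1; have d2 : 2 <= d%:R :> R by rewrite ler_nat.
nra.
Qed.

Let L4_ge1 : 1 <= L ^+ 4. Proof. exact: exprn_ege1. Qed.

Let p1 s : 1 <= q * (part_size m n s)%:R.
Proof. exact: le_trans L4_ge1 (qL s). Qed.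

Let Cd_ge1 : 1 <= C ^+ d.
Proof. by apply: exprn_ege1; apply: le_trans B_ge1 BC. Qed.

(** Since [4 * C ^+ d <= L], the hypotheses give [q * L ^+ 4 <= L ^+ 2 / 2]. *)
Let small X : L ^+ 4 <= X -> q * X <= 2 * (C ^+ d * L) -> q <= 2^-1.
Proof.
move=> hX hq; have hL := L_ge1; have hC := CL; have hCd := Cd_ge1.
have {hX} : q * L ^+ 4 <= 2 * (C ^+ d * L) by apply: le_trans hq; rewrite ler_wpM2l.
have -> : L ^+ 4 = L * L * (L * L) by ring.
move=> h; rewrite leNgt; apply/negP => qh.
have h2 : L * L * 1 <= L * L * (L * L) by rewrite ler_wpM2l; nra.
have : 2^-1 * (L * L * (L * L)) < q * (L * L * (L * L)) by rewrite ltr_pM2r //; nra.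
nra.
Qed.

(** The computation of [small] for [q * u]: as the product is at most [2 * C ^+ d * L] while [v] is
    at least [L ^+ 4], a level of nominal size [u] is small against [1 / q], as the growth step
    demands. *)
Let scaled_small u v : 0 <= u -> L ^+ 4 <= v -> q * u * v <= 2 * (C ^+ d * L) -> q * u <= 2^-1.
Proof.
move=> u0 hv huv; have hL := L_ge1; have hC := CL; have hCd := Cd_ge1.
have qu : 0 <= q * u by exact: mulr_ge0.
have {huv} : q * u * L ^+ 4 <= 2 * (C ^+ d * L) by apply: le_trans huv; rewrite ler_wpM2l.
have -> : L ^+ 4 = L * L * (L * L) by ring.
move=> h; rewrite leNgt; apply/negP => qh.
have h2 : L * L * 1 <= L * L * (L * L) by rewrite ler_wpM2l; nra.
have : 2^-1 * (L * L * (L * L)) < q * u * (L * L * (L * L)) by rewrite ltr_pM2r //; nra.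
nra.
Qed.

(** Different parts: depth [r] on both sides, length [r + r + 1 = d]. Same part: depths [r.+1] and
    [r], length [d.+1], where the additional factor of the form [q * part_size] is at least 1. The
    upper bound serves to keep the levels small. *)
Lemma odd_pairs r : (0 < r)%N -> d = (r + r).+1 ->
  C ^+ d * L <= q * (q ^+ 2 * (m%:R * n%:R)) ^+ r <= 2 * (C ^+ d * L) ->
  [/\ q <= 1,
      forall x y : vtx m n, x != y -> in_left x = in_left y ->
        prob q (fun E => ~~ `[< many_disjoint_paths E d.+1 x y (B * L) >]) <= expR (- (5 * L)) &
      forall x y : vtx m n, in_left x -> ~~ in_left y ->
        prob q (fun E => ~~ `[< many_disjoint_paths E d x y (B * L) >]) <= expR (- (5 * L))].
Proof.
move=> r0 ed /andP [Plo Phi].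
have G0 s j := growth_ge0 m n q_ge0 s j.
have GL s : L ^+ 4 <= growth m n q s r by apply: (growth_ge q_ge0).
have small_r s : q * growth m n q s r <= 2^-1.
  by apply: (scaled_small (v := growth m n q (~~ s) r)) => //; rewrite -mulrA growth_dual.
have q1 : q <= 1.
  apply: le_trans (_ : 2^-1 <= _); last lra.
  by apply: le_trans (small_r true); rewrite ler_peMr //; apply: le_trans L4_ge1 (GL _).
have q01 : 0 <= q <= 1 by rewrite q_ge0.
split=> // x y.
  move=> xy sxy; rewrite ed -[X in X.+1]addSn.
  apply: (prob_not_connected_le q01 d_ge2 B_ge BC L_ge qL) => //.
  - by rewrite ed addSn.
  - by rewrite /= sxy addbN.
  - apply: le_trans (small_r (in_left y)); rewrite ler_wpM2l //.
    by apply: (le_growth q_ge0); rewrite ?leq_pred.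
  apply: le_trans Plo _.
  rewrite growthSl sxy -(growth_dual m n q (~~ in_left y) r) negbK.
  have := p1 (~~ in_left y); set g := q * (part_size _ _ _)%:R => g1.
  have -> : q * (g * growth m n q (~~ in_left y) r) * growth m n q (in_left y) r =
    g * (q * (growth m n q (~~ in_left y) r * growth m n q (in_left y) r)) by ring.
  by rewrite ler_peMl // !mulr_ge0.
move=> sx sy; rewrite ed.
have xy : x != y by apply: contraTneq sx => ->.
have le_pred s : q * growth m n q s r.-1 <= 2^-1.
  apply: le_trans (small_r s); rewrite ler_wpM2l //.
  by apply: (le_growth q_ge0); rewrite ?leq_pred.
apply: (prob_not_connected_le q01 d_ge2 B_ge BC L_ge qL) => //.
- by rewrite ed.
- by rewrite sx (negbTE sy) addTb addFb.
by rewrite -mulrA sx (negbTE sy) growth_dual.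
Qed.

(** Same part: depths [r] and [r.-1], length [d]. Different parts: depth [r] on both sides, length
    [d.+1], which gains a factor [q * n >= 1]. *)
Lemma even_pairs r : (0 < r)%N -> d = (r + r)%N -> (m <= n)%N ->
  q * (q * m%:R) * (q ^+ 2 * (m%:R * n%:R)) ^+ r.-1 = C ^+ d * L ->
  [/\ q <= 1,
      forall x y : vtx m n, x != y -> in_left x = in_left y ->
        prob q (fun E => ~~ `[< many_disjoint_paths E d x y (B * L) >]) <= expR (- (5 * L)) &
      forall x y : vtx m n, in_left x -> ~~ in_left y ->
        prob q (fun E => ~~ `[< many_disjoint_paths E d.+1 x y (B * L) >]) <= expR (- (5 * L))].
Proof.
move=> r0 ed mn PE.
have G0 s j := growth_ge0 m n q_ge0 s j.
have CL0 : 0 <= C ^+ d * L by apply: mulr_ge0; [exact: le_trans Cd_ge1 | exact: le_trans L_ge1].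
have qm1 := p1 true; rewrite /part_size in qm1.
have qn1 := p1 false; rewrite /part_size in qn1.
have qmn : q * m%:R <= q * n%:R by rewrite ler_wpM2l // ler_nat.
have q2mn : 1 <= q ^+ 2 * (m%:R * n%:R) by nra.
have qh : q <= 2^-1.
  apply: (small (X := q * m%:R * (q ^+ 2 * (m%:R * n%:R)) ^+ r.-1)).
    apply: le_trans (qL true) _; rewrite ler_peMr ?exprn_ege1 //; lra.
  rewrite mulrA PE; lra.
have q1 : q <= 1 by lra.
have q01 : 0 <= q <= 1 by rewrite q_ge0.
(* One factor [q * part_size] remains unpaired; since [m <= n], its worst value is [q * m]. *)
have Pdual s : q * (q * (part_size m n s)%:R) * (growth m n q s r.-1 * growth m n q (~~ s) r.-1)
    >= C ^+ d * L.
  rewrite -PE growth_dual ler_wpM2r ?exprn_ge0 //; first lra.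
  by rewrite ler_wpM2l // /part_size; case: s.
have growth_r s : growth m n q s r = q * (part_size m n (~~ s))%:R * growth m n q (~~ s) r.-1.
  by rewrite -growthSl prednK.
(* For [d = 2] these bounds concern depth 0 and reduce to [q <= 1/2]. *)
have small_pred s : q * growth m n q s r.-1 <= 2^-1.
  case: (posnP r.-1) => [->|r1]; first by rewrite growth0 mulr1.
  have GL s' : L ^+ 4 <= growth m n q s' r.-1 by apply: (growth_ge q_ge0).
  apply: (scaled_small (v := growth m n q (~~ s) r.-1)) => //.
  rewrite -mulrA growth_dual; apply: le_trans (_ : C ^+ d * L <= _); last lra.
  rewrite -PE -mulrA ler_wpM2l // ler_peMl ?exprn_ge0 //; lra.
split=> // x y.
  (* For [d = 2] the second tree would have depth 0, so common neighbours are counted instead. *)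
  move=> xy sxy; case: (posnP r.-1) => [r1|r1].
    have d2 : d = 2 by rewrite ed -(prednK r0) r1.
    rewrite d2; apply: (prob_not_codegree_le q01 d_ge2 B_ge BC L_ge qL) => //.
    move: PE; rewrite d2 r1 expr0 mulr1 => <-; rewrite expr2 -mulrA ler_wpM2l // ler_wpM2l // ler_nat.
    by rewrite /part_size; case: in_left.
  have -> : d = (r + r.-1).+1 by rewrite ed -{2}(prednK r0) addnS.
  have edr : (r + r.-1 <= d)%N by rewrite ed leq_add2l leq_pred.
  apply: (prob_not_connected_le q01 d_ge2 B_ge BC L_ge qL) => //.
  - by rewrite sxy -{1}(prednK r0) /= addbN.
  - apply: le_trans (small_pred (in_left y)); rewrite ler_wpM2l //.
    by apply: (le_growth q_ge0); rewrite ?leq_pred.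
  apply: le_trans (Pdual (~~ in_left y)) _.
  by rewrite negbK growth_r sxy -!mulrA.
move=> sx sy; have xy : x != y by apply: contraTneq sx => ->.
rewrite ed; apply: (prob_not_connected_le q01 d_ge2 B_ge BC L_ge qL) => //.
- by rewrite ed.
- by rewrite sx (negbTE sy) addTb addFb.
rewrite -mulrA sx (negbTE sy) growth_dual -PE -{2}(prednK r0) [_ ^+ r.-1.+1]exprS [leRHS]mulrA.
rewrite ler_wpM2r ?exprn_ge0 //; first lra.
rewrite ler_wpM2l //; have -> : q ^+ 2 * (m%:R * n%:R) = q * m%:R * (q * n%:R) by ring.
by rewrite ler_peMr //; lra.
Qed.

End Pairs.

(** The clamping is the identity here, and the error is a union bound over at most [(m + n) ^ 2]
    ordered pairs. *)
Lemma Gmnp_prob_ge (R : realType) m n (q c e : R) Lsame Ldiff : 0 <= q <= 1 -> 0 <= e ->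
  (forall x y : vtx m n, x != y -> in_left x = in_left y ->
     prob q (fun E => ~~ `[< many_disjoint_paths E Lsame x y c >]) <= e) ->
  (forall x y : vtx m n, in_left x -> ~~ in_left y ->
     prob q (fun E => ~~ `[< many_disjoint_paths E Ldiff x y c >]) <= e) ->
  1 - (m + n)%:R ^+ 2 * e <= Gmnp_prob m n q (connectivity_prop Lsame Ldiff c).
Proof.
move=> q01 e0 hs hd; have [q0 q1] := andP q01.
have -> : Gmnp_prob m n q (connectivity_prop Lsame Ldiff c) =
    prob q (fun E : {set 'I_m * 'I_n} => `[< connectivity_prop Lsame Ldiff c E >]).
  rewrite /Gmnp_prob /clamp01 min_l // max_r // big_mkcond /=.
  apply: eq_bigr => E _; rewrite wtE card_prod !card_ord.
  by case: asboolP => _; rewrite ?mulr1 ?mulr0.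
rewrite lerBlDr -lerBlDl -prob_negb //.
(* These are the ordered pairs occurring in [connectivity_prop]; mixed pairs start on the left. *)
pose A (p : vtx m n * vtx m n) := (p.1 != p.2) &&
  ((in_left p.1 == in_left p.2) || in_left p.1).
pose len (p : vtx m n * vtx m n) :=
  if in_left p.1 == in_left p.2 then Lsame else Ldiff.
apply: le_trans (_ : prob q (fun E => [exists (p | A p),
    ~~ `[< many_disjoint_paths E (len p) p.1 p.2 c >]]) <= _).
  apply: le_prob => // E; apply: contraNT => /existsPn hE; apply/asboolP.
  have hp p : A p -> many_disjoint_paths E (len p) p.1 p.2 c.
    by move=> Ap; have := hE p; rewrite Ap /= negbK => /asboolP.
  split; last split.
  - by move=> u u' uu'; apply: (hp (inl u, inl u')); rewrite /A /= andbT.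
  - by move=> v v' vv'; apply: (hp (inr v, inr v')); rewrite /A /= andbT.
  by move=> u v; apply: (hp (inl u, inr v)).
apply: le_trans (prob_exists q01 _ _) _.
apply: le_trans (_ : \sum_(p : vtx m n * vtx m n) e <= _); last first.
  by rewrite sumr_const card_prod card_sum !card_ord -[leLHS]mulr_natl natrM expr2.
rewrite [leRHS](bigID A) /= -[leLHS]addr0 lerD //; last by apply: sumr_ge0.
apply: ler_sum => -[x y]; rewrite /A /len /= => /andP [xy].
case: eqP => /= [sxy _|]; first exact: hs.
by move=> sxy sx; apply: hd => //; move: sxy; rewrite sx; case: (in_left y).
Qed.

(** * Asymptotics *)

Lemma ln2_bounds (R : realType) : 0 < ln (2 : R) <= 1.
Proof. by rewrite ln_gt0 ?ltr1n //= -ler_expR lnK ?posrE //; have := expR_ge1Dx (1 : R); lra. Qed.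

Lemma ln_le_log2 (R : realType) n : (0 < n)%N -> ln (n%:R : R) <= log2 (n%:R : R).
Proof.
move=> n0; have /andP [l0 l1] := ln2_bounds R.
by rewrite /log2 ler_pdivlMr // ler_piMr // ln_ge0 // ler1n.
Qed.

Lemma log2_unbounded (R : realType) (T : R) :
  exists N : nat, forall n : nat, (N <= n)%N -> T <= log2 (n%:R : R).
Proof.
have /andP [l0 l1] := ln2_bounds R; exists (Num.truncn (expR (T * ln 2))).+1 => n Nn.
have h : expR (T * ln 2) <= n%:R.
  by apply: le_trans (ltW (truncnS_gt _)) _; rewrite ler_nat.
rewrite /log2 ler_pdivlMr // -ler_expR lnK // posrE; apply: lt_le_trans h; exact: expR_gt0.
Qed.

Lemma log2M_bounds (R : realType) m n : (0 < m <= n)%N ->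
  log2 (n%:R : R) <= log2 ((m * n)%:R : R) <= 2 * log2 (n%:R : R).
Proof.
case/andP => m0 mn; have n0 := leq_trans m0 mn; have /andP [l0 l1] := ln2_bounds R.
rewrite /log2 natrM lnM ?posrE ?ltr0n // mulrA !ler_pM2r ?invr_gt0 //.
have h1 : 0 <= ln (m%:R : R) by rewrite ln_ge0 // ler1n.
have h2 : ln (m%:R : R) <= ln n%:R by rewrite ler_ln ?posrE ?ltr0n // ler_nat.
by apply/andP; split; lra.
Qed.

(** Since [ln <= log2], the exponential is at most [n ^- 5], and [(2 * n) ^+ 2 * n ^- 5 <= n^-1]
    once [n >= 2]. *)
Lemma union_error_le (R : realType) m n : (2 <= n)%N -> (m <= n)%N ->
  (m + n)%:R ^+ 2 * expR (- (5 * log2 (n%:R : R))) <= n%:R `^ (-1).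
Proof.
move=> n2 mn; have n0 : (0 < n)%N by exact: ltnW.
have n2' : 2 <= n%:R :> R by rewrite ler_nat.
have -> : n%:R `^ (-1) = (n%:R)^-1 :> R by rewrite powR_inv1.
apply: le_trans (_ : (2 * n%:R) ^+ 2 * n%:R ^- 5 <= _).
  apply: ler_pM; rewrite ?exprn_ge0 ?expR_ge0 //.
    rewrite lerXn2r ?nnegrE ?mulr_ge0 // natrD.
    have : m%:R <= n%:R :> R by rewrite ler_nat.
    lra.
  rewrite -[X in _ <= X ^- 5]lnK ?posrE ?ltr0n // -expRM_natl -expRN ler_expR lerN2.
  by rewrite ler_wpM2l // ln_le_log2.
have nz : n%:R != 0 :> R by rewrite pnatr_eq0 -lt0n.
have -> : (2 * n%:R) ^+ 2 * n%:R ^- 5 = n%:R^-1 * (4 / n%:R ^+ 2) :> R by field.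
rewrite ler_piMr ?invr_ge0 // ler_pdivrMr; last by rewrite exprn_gt0 ?ltr0n.
by rewrite mul1r expr2 -natrM ler_nat; lia.
Qed.

Lemma powR_root (R : realType) (x : R) d : 0 <= x -> (0 < d)%N -> (x `^ (d%:R)^-1) ^+ d = x.
Proof.
move=> x0 d0; rewrite -powR_mulrn ?powR_ge0 // -powRrM mulVf ?powRr1 //.
by rewrite pnatr_eq0 -lt0n.
Qed.

Lemma powR_exprn (R : realType) (x e : R) d k : 0 <= x -> e * d%:R = k%:R ->
  (x `^ e) ^+ d = x ^+ k.
Proof. by move=> x0 ek; rewrite -powR_mulrn ?powR_ge0 // -powRrM ek powR_mulrn. Qed.

Lemma p1_ge0 (R : realType) d m n : 0 <= p1 R d m n.
Proof. by rewrite divr_ge0 ?mulr_ge0 ?powR_ge0. Qed.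

Lemma p2_ge0 (R : realType) d m n : 0 <= p2 R d m n.
Proof. by rewrite divr_ge0 ?mulr_ge0 ?powR_ge0. Qed.

Lemma log2_ge0 (R : realType) n : (0 < n)%N -> 0 <= log2 (n%:R : R).
Proof. by move=> n0; apply: le_trans (ln_le_log2 R n0); rewrite ln_ge0 // ler1n. Qed.

(** The [d]-th power clears the roots since [d - 1 = 2 * r]. The left side approximates the expected
    number of paths of length [d] between the parts. *)
Lemma p1_exprn (R : realType) d r m n : (0 < m)%N -> (0 < n)%N -> d = (r + r).+1 ->
  p1 R d m n ^+ d * (m%:R * n%:R) ^+ r = log2 ((m * n)%:R : R).
Proof.
move=> m0 n0 ed; have d0 : (0 < d)%N by rewrite ed.
have dz : d%:R != 0 :> R by rewrite pnatr_eq0 -lt0n.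
have e_r : (d%:R - 1) / (2 * d%:R) * d%:R = r%:R :> R.
  have -> : d%:R - 1 = 2 * r%:R :> R by rewrite ed -natr1 natrD; ring.
  by field.
rewrite /p1 expr_div_n powR_root ?log2_ge0 ?muln_gt0 ?m0 // exprMn.
rewrite !(powR_exprn _ e_r) // exprMn divfK // mulf_neq0 // expf_neq0 // pnatr_eq0 -lt0n //.
Qed.

(** Here [d - 2 = 2 * r.-1]. The left side approximates the expected number of paths of length [d]
    between two vertices of the part of size [n]. *)
Lemma p2_exprn (R : realType) d r m n : (0 < m)%N -> (0 < n)%N -> (0 < r)%N -> d = (r + r)%N ->
  p2 R d m n ^+ d * (m%:R ^+ r * n%:R ^+ r.-1) = log2 (n%:R : R).
Proof.
move=> m0 n0 r0 ed; have d0 : (0 < d)%N by rewrite ed addn_gt0 r0.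
have dz : d%:R != 0 :> R by rewrite pnatr_eq0 -lt0n.
have e_r : 2^-1 * d%:R = r%:R :> R by rewrite ed natrD; field.
have e_r1 : (d%:R - 2) / (2 * d%:R) * d%:R = r.-1%:R :> R.
  have -> : d%:R - 2 = 2 * r.-1%:R :> R by rewrite ed -(prednK r0) natrD -natr1 /=; ring.
  by field.
rewrite /p2 expr_div_n powR_root ?log2_ge0 // exprMn.
rewrite (powR_exprn _ e_r) // (powR_exprn _ e_r1) // divfK // mulf_neq0 // expf_neq0 // pnatr_eq0 -lt0n //.
Qed.

Lemma even_monomial (R : comPzRingType) (q a b : R) r : (0 < r)%N ->
  q * (q * a) * (q ^+ 2 * (a * b)) ^+ r.-1 = q ^+ (r + r) * (a ^+ r * b ^+ r.-1).
Proof.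
case: r => //= k _; rewrite (exprMn k (q ^+ 2)) (exprMn k a) addnS addSn addnn -mul2n.
rewrite -(addn2 (2 * k)) exprD exprM (exprS a k).
move: ((q ^+ 2) ^+ k) (a ^+ k) (b ^+ k) => u v w; ring.
Qed.

Lemma constants_le (R : realType) d (B C : R) : (2 <= d)%N -> 1 <= B -> B <= C ->
  forall L, 256 * d%:R * (d%:R + B + 6) + 4 * C ^+ d <= L ->
  [/\ 256 * d%:R * (d%:R + B + 6) <= L, 4 * C ^+ d <= L & 1 <= L].
Proof.
move=> d2 B1 BC L hL; have C1 : 1 <= C ^+ d by apply: exprn_ege1; exact: le_trans BC.
have d0 : 0 <= d%:R :> R by [].
have h : 0 <= 256 * d%:R * (d%:R + B + 6) by rewrite mulr_ge0 //; lra.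
by split; lra.
Qed.

(** The pair bounds are used with [L = log2 n], with [B] the constant in the path count, and with
    [C] the factor of the edge probability: [B] for odd [d], [B / eps] for even [d]. *)
Theorem theorem3 (R : realType) (d : nat) (c0 : R) :
  (2 <= d)%N -> 1 <= c0 ->
  (* odd case *)
  (odd d ->
   forall m : nat -> nat,
   (exists N0 : nat, forall n : nat, (N0 <= n)%N ->
      p1 R d (m n) n * (m n)%:R <= p1 R d (m n) n * n%:R /\
      (log2 (n%:R : R)) ^+ 4 <= p1 R d (m n) n * (m n)%:R) ->
   exists delta : R, 0 < delta /\ exists N : nat, forall n : nat, (N <= n)%N ->
     1 - (n%:R : R) `^ (- delta) <=
     Gmnp_prob (m n) n (2 ^+ (10 * d) * c0 * p1 R d (m n) n)
       (connectivity_prop d.+1 d (2 ^+ (10 * d) * c0 * log2 (n%:R : R)))) /\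
  (* even case *)
  (~~ odd d ->
   forall eps : R, 0 < eps < 1 ->
   forall m : nat -> nat,
   (exists N0 : nat, forall n : nat, (N0 <= n)%N ->
      p2 R d (m n) n * (m n)%:R `^ (1 - eps) <= p2 R d (m n) n * n%:R `^ (1 - eps) /\
      (log2 (n%:R : R)) ^+ 4 <= p2 R d (m n) n * (m n)%:R `^ (1 - eps)) ->
   exists delta : R, 0 < delta /\ exists N : nat, forall n : nat, (N <= n)%N ->
     1 - (n%:R : R) `^ (- delta) <=
     Gmnp_prob (m n) n (2 ^+ (10 * d) * c0 / eps * p2 R d (m n) n)
       (connectivity_prop d d.+1 (2 ^+ (10 * d) * c0 * log2 (n%:R : R)))).
Proof.
move=> d2 c01; set B := 2 ^+ (10 * d) * c0.
have pow_ge1 : 1 <= 2 ^+ (10 * d) :> R by rewrite exprn_ege1 // ler1n.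
have B_ge : 2 ^+ (10 * d) <= B by rewrite ler_peMr //; lra.
have B1 : 1 <= B by exact: le_trans B_ge.
split=> [d_odd m [N0 hN0]|d_even eps /andP [eps0 eps1] m [N0 hN0]].
  have [N1 hN1] := log2_unbounded (256 * d%:R * (d%:R + B + 6) + 4 * B ^+ d).
  (* The exponent 1 comes from [union_error_le]; [N1] makes [log2 n] exceed all the constants. *)
  exists 1; split=> //; exists (maxn 2 (maxn N0 N1)) => n.
  rewrite !geq_max => /and3P [n2 /hN0 [pmn pm] /hN1 hL].
  have [L1 L2 L_ge1] := constants_le d2 B1 (lexx B) hL.
  set L := log2 n%:R in pm hL L1 L2 L_ge1 *; set p := p1 R d (m n) n in pmn pm *.
  have n0 : (0 < n)%N by exact: ltnW.
  have L4 : 0 < L ^+ 4 by rewrite exprn_gt0 //; lra.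
  have p0 : 0 <= p := p1_ge0 R d (m n) n.
  have p_gt0 : 0 < p.
    by rewrite lt_neqAle p0 andbT; apply/eqP => e; move: pm; rewrite -e mul0r; lra.
  have m0 : (0 < m n)%N.
    by rewrite lt0n; apply/eqP => e; move: pm; rewrite e mulr0; lra.
  have mn : (m n <= n)%N by move: pmn; rewrite ler_pM2l // ler_nat.
  set q := B * p; have q0 : 0 <= q by rewrite mulr_ge0 //; lra.
  have qL s : L ^+ 4 <= q * (part_size (m n) n s)%:R.
    apply: le_trans pm _; apply: ler_pM; rewrite // ?ler_peMl // ler_nat.
    by case: s.
  have [r ed] : exists r, d = (r + r).+1.
    by exists d./2; rewrite addnn -{1}(odd_double_half d) d_odd.
  have r0 : (0 < r)%N by rewrite lt0n; apply/eqP => e; rewrite ed e in d2.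
  have PE : q * (q ^+ 2 * ((m n)%:R * n%:R)) ^+ r = B ^+ d * log2 ((m n * n)%:R).
    rewrite -(p1_exprn R m0 n0 ed) -/p [RHS]mulrA -[in RHS]exprMn -/q ed.
    by rewrite exprMn -exprM mul2n -addnn mulrA -exprS.
  have /andP [l1 l2] : L <= log2 ((m n * n)%:R) <= 2 * L by apply: log2M_bounds; rewrite m0.
  have [|q1 hs hd] := odd_pairs q0 d2 B_ge (lexx B) L1 L2 qL r0 ed.
    have Bd : 0 <= B ^+ d by rewrite exprn_ge0 //; lra.
    by rewrite PE; apply/andP; split; [exact: ler_wpM2l Bd _ _ l1 | rewrite [leRHS]mulrCA; exact: ler_wpM2l Bd _ _ l2].
  apply: le_trans (Gmnp_prob_ge _ (expR_ge0 _) hs hd); last by rewrite q0.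
  by rewrite lerD2l lerN2; exact: union_error_le.
have [r ed] : exists r, d = (r + r)%N.
  by exists d./2; rewrite addnn -{1}(odd_double_half d) (negbTE d_even).
have r0 : (0 < r)%N by rewrite lt0n; apply/eqP => e; rewrite ed e in d2.
set C := B / eps; have BC : B <= C.
  rewrite ler_pdivlMr // ler_piMr //; lra.
have [N1 hN1] := log2_unbounded (256 * d%:R * (d%:R + B + 6) + 4 * C ^+ d).
exists 1; split=> //; exists (maxn 2 (maxn N0 N1)) => n.
rewrite !geq_max => /and3P [n2 /hN0 [pmn pm] /hN1 hL].
have [L1 L2 L_ge1] := constants_le d2 B1 BC hL.
set L := log2 n%:R in pm hL L1 L2 L_ge1 *; set p := p2 R d (m n) n in pmn pm *.
have n0 : (0 < n)%N by exact: ltnW.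
have L4 : 0 < L ^+ 4 by rewrite exprn_gt0 //; lra.
have p0 : 0 <= p := p2_ge0 R d (m n) n.
have p_gt0 : 0 < p.
  by rewrite lt_neqAle p0 andbT; apply/eqP => e; move: pm; rewrite -e mul0r; lra.
have eps_gt0 : 0 < 1 - eps by lra.
(* A power of 0 vanishes only for a nonzero exponent, hence the use of [eps < 1]. *)
have m0 : (0 < m n)%N.
  rewrite lt0n; apply/eqP => e; move: pm; rewrite e powR0 ?mulr0; first lra.
  by rewrite gt_eqF.
(* The power with exponent [1 - eps] is strictly increasing, so the hypothesis can be compared at
   its bases. *)
have mn : (m n <= n)%N.
  rewrite leqNgt; apply/negP => nm; move: pmn; rewrite ler_pM2l // leNgt => /negP; apply.
  by apply: gt0_ltr_powR; rewrite ?nnegrE // ltr_nat.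
(* Raising the exponent from [1 - eps] to 1 can only increase a base that is at least 1. *)
have {}pm : L ^+ 4 <= p * (m n)%:R.
  apply: le_trans pm _; rewrite ler_wpM2l // ler1_powR ?ler1n //; lra.
set q := C * p; have q0 : 0 <= q by rewrite mulr_ge0 //; lra.
have qL s : L ^+ 4 <= q * (part_size (m n) n s)%:R.
  apply: le_trans pm _; apply: ler_pM => //; last by rewrite ler_nat; case: s.
  by rewrite ler_peMl //; lra.
have PE : q * (q * (m n)%:R) * (q ^+ 2 * ((m n)%:R * n%:R)) ^+ r.-1 = C ^+ d * L.
  rewrite /L -(p2_exprn R m0 n0 r0 ed) -/p [RHS]mulrA -[in RHS]exprMn -/q ed.
  exact: even_monomial.
have [q1 hs hd] := even_pairs q0 d2 B_ge BC L1 L2 qL r0 ed mn PE.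
apply: le_trans (Gmnp_prob_ge _ (expR_ge0 _) hs hd); last by rewrite q0.
by rewrite lerD2l lerN2; exact: union_error_le.
Qed.
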